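(* Let $N$ be a positive integer and let $t_1,t_2,s_1,s_2$ be non-negative integers with $t_2<N$, $s_2<N$ and $t_1+t_2=s_1+s_2$. If a subspace $\mathcal{C}\subseteq(\mathbb{C}^q)^{\otimes N}$ is a $(t_1,t_2)$-insdel code, then $\mathcal{C}$ is also an $(s_1,s_2)$-insdel code.
   Context: Fix an integer $q\ge 2$. For a positive integer $m$ let $[m]=\{1,\dots,m\}$, and let $S(\mathbb{C}^{q\otimes m})$ denote the set of density matrices (positive semidefinite, trace one) on $(\mathbb{C}^q)^{\otimes m}$. Let $|0\rangle,\dots,|q-1\rangle$ be the standard basis of $\mathbb{C}^q$, and for $\bm{x}\in\{0,\dots,q-1\}^m$ write $|\bm{x}\rangle=|x_1\rangle\otimes\cdots\otimes|x_m\rangle$. For $p\in[m+1]$ and $\sigma\in S(\mathbb{C}^q)$, the map $\mathrm{In}^m_{p,\sigma}$ is the linear map from $q^m\times q^m$ matrices to $q^{m+1}\times q^{m+1}$ matrices given on matrix units by $|\bm{x}\rangle\langle\bm{y}|\mapsto |x_1\rangle\langle y_1|\otimes\cdots\otimes|x_{p-1}\rangle\langle y_{p-1}|\otimes\sigma\otimes|x_p\rangle\langle y_p|\otimes\cdots\otimes|x_m\rangle\langle y_m|$ (i.e. $\sigma$ becomes the $p$-th tensor factor). For $p\in[m]$, $\mathrm{Tr}^m_p$ is the partial trace over the $p$-th tensor factor of $(\mathbb{C}^q)^{\otimes m}$. Insertion: for $t\ge1$, a set $P=\{p_1<\dots<p_t\}\subseteq[N+t]$ and a product state $\sigma=\sigma_1\otimes\cdots\otimes\sigma_t$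 with each $\sigma_i\in S(\mathbb{C}^q)$, set $\mathrm{Ins}^N_{P,\sigma}=\mathrm{In}^{N+t-1}_{p_t,\sigma_t}\circ\cdots\circ\mathrm{In}^{N+1}_{p_2,\sigma_2}\circ\mathrm{In}^N_{p_1,\sigma_1}$. A $t$-insertion channel is any map of the form $\mathrm{Ins}^N_t(\rho)=\int\mu(\sigma)\sum_{P\subseteq[N+t],|P|=t}p_\sigma(P)\,\mathrm{Ins}^N_{P,\sigma}(\rho)\,d\sigma$, where the integral ranges over such product states $\sigma$, $\mu$ is a probability measure and each $p_\sigma$ is a probability distribution on $t$-subsets. Deletion: for $1\le t<N$ and $P=\{p_1<\dots<p_t\}\subseteq[N]$, set $\mathrm{Era}^N_P=\mathrm{Tr}^{N-t+1}_{p_1}\circ\cdots\circ\mathrm{Tr}^{N-1}_{p_{t-1}}\circ\mathrm{Tr}^N_{p_t}$. A $t$-deletion channel is any map $\mathrm{Del}^N_t(\rho)=\sum_{|P|=t}p(P)\,\mathrm{Era}^N_P(\rho)$ with $p$ a probability distribution on $t$-subsets of $[N]$. The $0$-insertion and $0$-deletion channels are identity maps. For non-negative integers $t_1,t_2$ with $t_2<N$, a $(t_1,t_2)$-insdel channel is any composition $\mathrm{InsDel}^N_{t_1,t_2}=\mathrm{Ins}^{N-t_2}_{t_1}\circ\mathrm{Del}^N_{t_2}$ of a $t_1$-insertion channel (on $N-t_2$ qudits) with a $t_2$-deletion channel (on $N$ qudits). A subspace $\mathcal{C}\subseteq(\mathbb{C}^q)^{\otimes N}$ is a $(t_1,t_2)$-insdel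 code if for every $(t_1,t_2)$-insdel channel $\mathcal{N}$ there is a quantum channel (completely positive trace-preserving map) $\mathcal{R}$ with $\mathcal{R}(\mathcal{N}(\rho))=\rho$ for every density matrix $\rho$ supported on $\mathcal{C}$. *)

(* Defs.v *)
From HB Require Import structures.
From mathcomp Require Import all_boot all_order all_algebra.
From mathcomp Require Import complex.
From mathcomp Require Import all_classical all_reals.
From mathcomp Require Import ereal topology normedtype sequences measure
  lebesgue_measure lebesgue_integral probability.

Set Implicit Arguments.
Unset Strict Implicit.
Unset Printing Implicit Defensive.

Import Order.TTheory GRing.Theory Num.Theory.
Local Open Scope ring_scope.

(* Conventions.  The scalar field is C := R[i] for an arbitrary realType R  *)
(* (a model of the real numbers).  The Hilbert space (C^q)^{\otimes m} has  *)
(* computational basis |x>, x in {0,..,q-1}^m, encoded as x : 'I_m -> 'I_q  *)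
(* (positions are 0-based: position k : 'I_m is the (k+1)-th tensor factor).*)
(* Operators on it are functions  idx q m -> idx q m -> C, i.e. the matrix  *)
(* A with entries A x y = <x|A|y>.                                          *)

Section QDefs.
Variable R : realType.
Local Notation C := (R[i]).

Definition idx (q m : nat) := {ffun 'I_m -> 'I_q}.

Definition op (q m : nat) := idx q m -> idx q m -> C.
Definition vec (q m : nat) := idx q m -> C.

Definition mtrace (T : finType) (A : T -> T -> C) : C := \sum_x A x x.

Definition psd (T : finType) (A : T -> T -> C) : Prop :=
  (forall x y, A y x = conjc (A x y)) /\
  (forall v : T -> C, 0 <= \sum_x \sum_y conjc (v x) * A x y * v y).

Definition density (T : finType) (A : T -> T -> C) : Prop :=
  psd A /\ mtrace A = 1.

Definition qstate (q : nat) := 'I_q -> 'I_q -> C.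

Definition idx_del q m (k : 'I_m.+1) (x : idx q m.+1) : idx q m :=
  [ffun i : 'I_m => x (lift k i)].
Definition idx_ins q m (k : 'I_m.+1) (a : 'I_q) (x : idx q m) : idx q m.+1 :=
  [ffun j : 'I_m.+1 => if unlift k j is Some i then x i else a].

(* In^m_{k+1,sigma}: |x><y| |-> ... (x) sigma (x) ... with sigma as the     *)
(* (k+1)-th tensor factor; on matrix entries this is                        *)
(*   In(rho)(x',y') = sigma(x'_k, y'_k) * rho(del_k x', del_k y').          *)
Definition In q m (k : 'I_m.+1) (sigma : qstate q) (rho : op q m) : op q m.+1 :=
  fun x y => sigma (x k) (y k) * rho (idx_del k x) (idx_del k y).

Definition Trp q m (k : 'I_m.+1) (rho : op q m.+1) : op q m :=
  fun x y => \sum_(a < q) rho (idx_ins k a x) (idx_ins k a y).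

(* versions with a (0-based) natural-number position; the position is      *)
(* always in range where these are used below                              *)
Definition In_nat q m (p : nat) (sigma : qstate q) (rho : op q m) : op q m.+1 :=
  In (inord p) sigma rho.
Definition Tr_nat q m (p : nat) : op q m -> op q m.-1 :=
  match m as m0 return op q m0 -> op q m0.-1 with
  | 0 => fun rho => rho
  | m'.+1 => fun rho => Trp (inord p) rho
  end.

(* casting an operator between (provably equal) numbers of qudits; only    *)
(* used when the two numbers are equal                                     *)
Definition opcast q m n (A : op q m) : op q n :=
  match m =P n with
  | ReflectT e => ecast k (op q k) e A
  | ReflectF _ => fun _ _ => 0
  end.

(* iterated insertion: In^{m+t-1}_{p_t,s_t} o ... o In^m_{p_1,s_1}, where *)
(* l = [:: (p_1,s_1); ...; (p_t,s_t)] (0-based positions)                  *)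
Fixpoint ins_tgt (A : Type) (m : nat) (l : seq A) : nat :=
  if l is _ :: l' then ins_tgt m.+1 l' else m.

Fixpoint ins_seq q (l : seq (nat * qstate q)) {struct l} :
  forall m, op q m -> op q (ins_tgt m l) :=
  match l return forall m, op q m -> op q (ins_tgt m l) with
  | [::] => fun m rho => rho
  | (p, s) :: l' => fun m rho => @ins_seq q l' m.+1 (In_nat p s rho)
  end.

(* iterated partial trace: Tr_{p_1} o ... o Tr_{p_t}, where                *)
(* l = [:: p_t; ...; p_1] (the first element is traced out first)         *)
Fixpoint era_tgt (m : nat) (l : seq nat) : nat :=
  if l is _ :: l' then era_tgt m.-1 l' else m.

Fixpoint era_seq q (l : seq nat) {struct l} :
  forall m, op q m -> op q (era_tgt m l) :=
  match l return forall m, op q m -> op q (era_tgt m l) with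
  | [::] => fun m rho => rho
  | p :: l' => fun m rho => @era_seq q l' m.-1 (Tr_nat p rho)
  end.

(* Ins^N_{P,sigma} for P = {p_1 < ... < p_t} (0-based, subset of 'I_(N+t)) *)
(* and sigma = sigma_1 (x) ... (x) sigma_t, given as the t-tuple of factors *)
Definition Ins q N t (P : {set 'I_(N + t)}) (sigma : t.-tuple (qstate q))
    (rho : op q N) : op q (N + t) :=
  opcast (@ins_seq q (zip (sort leq [seq val i | i <- enum P]) sigma) N rho).

Definition Era q N t (P : {set 'I_N}) (rho : op q N) : op q (N - t) :=
  opcast (@era_seq q (sort geq [seq val i | i <- enum P]) N rho).

Definition cint d (T : measurableType d) (mu : {measure set T -> \bar R})
    (f : T -> C) : C :=
  Complex (\int[mu]_(w in setT) complex.Re (f w)) (\int[mu]_(w in setT) complex.Im (f w)).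

(* t-insertion channels on N qudits:                                        *)
(*   Ins(rho) = \int mu(sigma) \sum_{|P| = t} p_sigma(P) Ins_{P,sigma}(rho)  *)
(* The integration variable ranges over an abstract probability space Omega *)
(* carrying the product state sigma(w) and the distribution p_w on          *)
(* t-subsets.                                                *)
Definition ins_channel q N t (Phi : op q N -> op q (N + t)) : Prop :=
  exists (d : measure_display) (Omega : measurableType d)
         (mu : probability Omega R)
         (sigma : Omega -> t.-tuple (qstate q))
         (p : Omega -> {set 'I_(N + t)} -> R),
    (forall w i, density (tnth (sigma w) i)) /\
    (forall w (P : {set 'I_(N + t)}), 0 <= p w P) /\
    (forall w (P : {set 'I_(N + t)}), #|P| != t -> p w P = 0) /\
    (forall w, \sum_(P : {set 'I_(N + t)} | #|P| == t) p w P = 1) /\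
    (forall i a b,
            measurable_fun setT (fun w => complex.Re (tnth (sigma w) i a b)) /\
            measurable_fun setT (fun w => complex.Im (tnth (sigma w) i a b))) /\
    (forall P : {set 'I_(N + t)}, measurable_fun setT (fun w => p w P)) /\
    (forall rho x y,
            Phi rho x y =
            cint mu (fun w => \sum_(P : {set 'I_(N + t)} | #|P| == t)
                               (p w P)%:C%C * Ins P (sigma w) rho x y)).

Definition del_channel q N t (Phi : op q N -> op q (N - t)) : Prop :=
  exists p : {set 'I_N} -> R,
    [/\ (forall P : {set 'I_N}, 0 <= p P),
        (forall P : {set 'I_N}, #|P| != t -> p P = 0),
        \sum_(P : {set 'I_N} | #|P| == t) p P = 1 &
        (forall rho x y,
            Phi rho x y =
            \sum_(P : {set 'I_N} | #|P| == t) (p P)%:C%C * @Era q N t P rho x y)].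

Definition linear_op q m n (Phi : op q m -> op q n) : Prop :=
  forall (a : C) (A B : op q m),
    Phi (fun x y => a * A x y + B x y) = (fun x y => a * Phi A x y + Phi B x y).

(* id_k (x) Phi maps positive semidefinite operators to psd operators,      *)
(* for every ancilla dimension k                                            *)
Definition completely_positive q m n (Phi : op q m -> op q n) : Prop :=
  forall (k : nat) (X : ('I_k * idx q m) -> ('I_k * idx q m) -> C),
    psd X -> psd (fun u v => Phi (fun x y => X (u.1, x) (v.1, y)) u.2 v.2).

Definition trace_preserving q m n (Phi : op q m -> op q n) : Prop :=
  forall A : op q m, mtrace (Phi A) = mtrace A.

Definition quantum_channel q m n (Phi : op q m -> op q n) : Prop :=
  [/\ linear_op Phi, completely_positive Phi & trace_preserving Phi].

Definition code_subspace q N (S : vec q N -> Prop) : Prop :=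
  S (fun _ => 0) /\
  (forall (a : C) (u v : vec q N), S u -> S v -> S (fun x => a * u x + v x)).

Definition supported_on q N (S : vec q N -> Prop) (rho : op q N) : Prop :=
  forall v : vec q N, S (fun x => \sum_y rho x y * v y).

Definition insdel_code q N t1 t2 (S : vec q N -> Prop) : Prop :=
  forall (Phi1 : op q (N - t2) -> op q (N - t2 + t1))
         (Phi2 : op q N -> op q (N - t2)),
    ins_channel Phi1 -> del_channel Phi2 ->
    exists Rec : op q (N - t2 + t1) -> op q N,
      quantum_channel Rec /\
      (forall rho : op q N, density rho -> supported_on S rho ->
          Rec (Phi1 (Phi2 rho)) = rho).

End QDefs.

(* Main.v *)
(** Knill-Laflamme argument.  Deleting [t2] letters and then inserting [t1]
    letters has Kraus operators given by edit scripts (keep, drop a letter, add a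
    letter).  If a code corrects the insdel channel that deletes and inserts at
    uniformly random places and inserts maximally mixed states, then the product
    [E^* F] of any two scripts maps a codeword to a vector whose overlap with every
    orthogonal codeword vanishes.  Such a product is either zero or again a script,
    dropping at most [t1 + t2] letters; conversely every script dropping and adding
    at most [t1 + t2] letters is a sum of such products.  Hence this orthogonality
    property only depends on [t1 + t2].  It also suffices for recovery: on the code,
    the Kraus operators factor through an isometric copy of a tensor product
    of an auxiliary space with the code, so any channel that is a complex combination
    of maps [rho |-> E rho F^*] is undone, up to a scalar fixed by the trace, by
    projecting onto that copy and discarding the auxiliary space. *)

Require Import Defs.
From HB Require Import structures.
From mathcomp Require Import all_boot all_order all_algebra.
From mathcomp Require Import complex.
From mathcomp Require Import all_classical all_reals.
From mathcomp Require Import ereal topology normedtype sequences measure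
  lebesgue_measure lebesgue_integral probability.
From mathcomp Require Import measurable_realfun zify ring lra.

Set Implicit Arguments.
Unset Strict Implicit.
Unset Printing Implicit Defensive.

Import Order.TTheory GRing.Theory Num.Theory.

(** * Edit scripts *)

(** Positions shift under every insertion and deletion. A script instead reads both words from left
    to right and fixes the letters it drops and adds, so its matrix is a partial injection of basis
    words, and products need no position arithmetic. The counts do not match directly: a Kraus
    operator makes exactly [t2] deletions and [t1] insertions, a script at most [t1 + t2] drops. Two
    exchanges repair this. Missing drops are created by writing the identity on a kept letter as the
    sum over [c] of dropping [c] and adding [c] again; [t2 < N] guarantees a letter to split.
    Missing insertions are created by adding the same letter in both factors of [E^* F], where it
    cancels. The first exchange produces sums, so the condition carried along must be linear in
    [E^* F]: this is why it reads [u] orthogonal to [v] implies [E u] orthogonal to [F v], the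
    scalars of the Knill-Laflamme condition being recovered later. Inserted states may have
    off-diagonal entries, so a general channel contains terms [E rho F^*] with [E] different from
    [F]; allowing such terms with complex weights avoids diagonalising the inserted states. *)

Inductive edit (T : Type) := Keep | Drop of T | Add of T.
Arguments Keep {T}.

Fixpoint runs (T : eqType) (e : seq (edit T)) (x z : seq T) : bool :=
  match e with
  | [::] => nilp x && nilp z
  | Keep :: e' =>
      if x is c :: x' then if z is d :: z' then (c == d) && runs e' x' z' else false
      else false
  | Drop a :: e' => if x is c :: x' then (c == a) && runs e' x' z else false
  | Add b :: e' => if z is d :: z' then (d == b) && runs e' x z' else false
  end.

Definition flip T (h : edit T) : edit T :=
  match h with Keep => Keep | Drop a => Add a | Add b => Drop b end.

Fixpoint dropped T (e : seq (edit T)) : seq T :=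
  match e with
  | [::] => [::]
  | Drop a :: e' => a :: dropped e'
  | _ :: e' => dropped e'
  end.

Fixpoint drop_pos T (e : seq (edit T)) : seq nat :=
  match e with
  | [::] => [::]
  | Keep :: e' => map S (drop_pos e')
  | Drop _ :: e' => 0 :: map S (drop_pos e')
  | Add _ :: e' => drop_pos e'
  end.

Fixpoint keeps T (e : seq (edit T)) : nat :=
  match e with
  | [::] => 0
  | Keep :: e' => (keeps e').+1
  | _ :: e' => keeps e'
  end.

Notation added e := (dropped (map (@flip _) e)).
Notation add_pos e := (drop_pos (map (@flip _) e)).

Lemma flipK T : involutive (@flip T). Proof. by case. Qed.

Lemma keeps_flip T (e : seq (edit T)) : keeps (map (@flip T) e) = keeps e.
Proof. by elim: e => [|[|a|b] e IH] //=; rewrite IH. Qed.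

Lemma runs_flip (T : eqType) (e : seq (edit T)) x z :
  runs (map (@flip T) e) z x = runs e x z.
Proof.
elim: e x z => [|[|a|b] e IH] [|c x] [|d z] //=; rewrite ?IH //.
by rewrite eq_sym.
Qed.

Lemma runs_size (T : eqType) (e : seq (edit T)) x z : runs e x z ->
  size x = keeps e + size (dropped e) /\ size z = keeps e + size (added e).
Proof.
elim: e x z => [|[|a|b] e IH] [|c x] [|d z] //= /andP[_ /IH] []; move=> /= *; split; lia.
Qed.

Lemma runs_inj (T : eqType) (e : seq (edit T)) x z z' :
  runs e x z -> runs e x z' -> z = z'.
Proof.
elim: e x z z' => [|[|a|b] e IH] [|c x] [|d z] [|d' z'] //=;
  by move=> /andP[/eqP ? /IH h] /andP[/eqP ? /h]; congruence.
Qed.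

(** * Composition and factorisation of scripts *)

Definition relay (T : eqType) (e f : seq (edit T)) (x z : seq T) : Prop :=
  exists2 y, runs e x y & runs f y z.

(** The two scripts are merged from the left. A drop of [e] and an addition of [f] pass straight to
    the result; otherwise the heads meet on a letter of the middle word. Only an addition of [e] met
    by a drop of [f] interacts: the two cancel if the letters agree, and the composite is empty if
    not. The inner induction on [f] is needed because additions of [f] consume nothing of [e]. *)
Lemma runs_relay (T : eqType) (e f : seq (edit T)) :
  (exists2 g, size (dropped g) <= size (dropped e) + size (dropped f) &
     forall x z, runs g x z <-> relay e f x z) \/
  (forall x z, ~ relay e f x z).
Proof.
elim: e f => [|h e IHe].
  elim=> [|k f IHf].
    left; exists [::] => // x z; split; last by case=> y /=; case: x; case: y; case: z.
    by case: x; case: z => //= _; exists [::].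
  case: k => [|b|b].
  - by right=> x z [y] /=; case: y => //; case: x.
  - by right=> x z [y] /=; case: y => //; case: x.
  - case: IHf => [[g sg Hg]|H0]; [left|right].
      exists (Add b :: g) => // x [|d z] /=; first by split=> // -[].
      split; first by case/andP=> /eqP-> /Hg [y Hy Hf]; exists y => //=; rewrite eqxx.
      by case=> y Hy /andP[-> Hf]; apply/Hg; exists y.
    by move=> x [|d z] [y] //= Hy /andP[_ Hf]; apply: (H0 x z); exists y.
case: h => [|a|a].
- elim=> [|k f IHf].
    by right=> x z [y] /=; case: x => //; case: y.
  case: k => [|b|b].
  + case: (IHe f) => [[g sg Hg]|H0]; [left|right].
      exists (Keep :: g) => // [[|c x]] [|d z] /=; try by split=> // -[[|? ?]].
      split; first by case/andP=> /eqP-> /Hg [y Hy Hf]; exists (d :: y); rewrite /= eqxx.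
      case=> -[|c' y] //= /andP[/eqP-> He] /andP[-> Hf].
      by apply/Hg; exists y.
    move=> [|c x] [|d z] [[|c' y]] //= /andP[_ He] /andP[_ Hf].
    by apply: (H0 x z); exists y.
  + case: (IHe f) => [[g sg Hg]|H0]; [left|right].
      exists (Drop b :: g) => /=; first by lia.
      move=> [|c x] z /=; first by split=> // -[[|? ?]].
      split; first by case/andP=> /eqP-> /Hg [y Hy Hf]; exists (b :: y); rewrite /= eqxx.
      case=> -[|c' y] //= /andP[/eqP-> He] /andP[-> Hf].
      by apply/Hg; exists y.
    move=> [|c x] z [[|c' y]] //= /andP[_ He] /andP[_ Hf].
    by apply: (H0 x z); exists y.
  + case: IHf => [[g sg Hg]|H0]; [left|right].
      exists (Add b :: g) => // x [|d z]; first by split=> // -[].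
      split; first by case/andP=> /eqP-> /Hg [y Hy Hf]; exists y => //=; rewrite eqxx.
      by case=> y Hy /andP[/eqP-> Hf]; rewrite /= eqxx; apply/Hg; exists y.
    by move=> x [|d z] [y] // Hy /andP[_ Hf]; apply: (H0 x z); exists y.
- move=> f; case: (IHe f) => [[g sg Hg]|H0]; [left|right].
    exists (Drop a :: g) => //= -[|c x] z /=; first by split=> // -[].
    split; first by case/andP=> /eqP-> /Hg [y Hy Hf]; exists y => //=; rewrite eqxx.
    by case=> y /andP[-> Hy] Hf; apply/Hg; exists y.
  by move=> [|c x] z [y] //= /andP[_ Hy] Hf; apply: (H0 x z); exists y.
- elim=> [|k f IHf].
    by right=> x z [[|c y]].
  case: k => [|b|b].
  + case: (IHe f) => [[g sg Hg]|H0]; [left|right].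
      exists (Add a :: g) => // x [|d z] /=; first by split=> // -[[|? ?]].
      split; first by case/andP=> /eqP-> /Hg [y Hy Hf]; exists (a :: y); rewrite /= eqxx.
      case=> -[|c' y] //= /andP[/eqP-> He] /andP[/eqP<- Hf].
      by rewrite eqxx; apply/Hg; exists y.
    move=> x [|d z] [[|c' y]] //= /andP[_ He] /andP[_ Hf].
    by apply: (H0 x z); exists y.
  + case: (eqVneq a b) => [<-|nab]; last first.
      right=> x z [[|c y]] //= /andP[/eqP-> _] /andP[/eqP/esym E _].
      by rewrite E eqxx in nab.
    case: (IHe f) => [[g sg Hg]|H0]; [left|right].
      exists g => /=; first by lia.
      move=> x z; split; first by case/Hg=> y Hy Hf; exists (a :: y); rewrite /= eqxx.
      by case=> -[|c y] //= /andP[_ He] /andP[_ Hf]; apply/Hg; exists y.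
    by move=> x z [[|c y]] //= /andP[_ He] /andP[_ Hf]; apply: (H0 x z); exists y.
  + case: IHf => [[g sg Hg]|H0]; [left|right].
      exists (Add b :: g) => // x [|d z]; first by split=> // -[].
      split; first by case/andP=> /eqP-> /Hg [y Hy Hf]; exists y => //=; rewrite eqxx.
      by case=> y Hy /andP[/eqP-> Hf]; rewrite /= eqxx; apply/Hg; exists y.
    by move=> x [|d z] [y] // Hy /andP[_ Hf]; apply: (H0 x z); exists y.
Qed.

(* Every letter dropped (resp. added) by [m] is either dropped on its own side
   or produced by the other side. *)
Lemma relay_factor (T : eqType) (m : seq (edit T)) (i j : nat) :
  i <= size (dropped m) -> j <= size (added m) ->
  exists e f : seq (edit T),
    [/\ size (dropped e) = i, size (added e) = size (added m) - j,
        size (dropped f) = j, size (added f) = size (dropped m) - i &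
        forall x y, runs m x y <-> relay e (map (@flip T) f) x y].
Proof.
elim: m i j => [|[|a|b] m IH] i j /=.
- move=> Hi Hj; exists [::], [::]; split=> /=; try lia.
  by move=> [|? ?] [|? ?]; split=> //=; [exists [::]|case=> -[]|case=> -[]|case=> -[]].
- move=> Hi Hj; have [e [f [e1 e2 e3 e4 H]]] := IH i j Hi Hj.
  exists (Keep :: e), (Keep :: f); split=> //= -[|c x] [|d y] /=; try by split=> // -[[|? ?]].
  split; first by case/andP=> /eqP-> /H [z Hz Hf]; exists (d :: z); rewrite /= eqxx.
  by case=> -[|c' z] //= /andP[/eqP-> Hz] /andP[-> Hf]; apply/H; exists z.
(* With no drops left for [e], the letter passes through [e] and is dropped by the flipped [f];
   hence [f] itself adds it. *)
- case: i => [|i] Hi Hj.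
    have [e [f [e1 e2 e3 e4 H]]] := IH 0 j isT Hj.
    exists (Keep :: e), (Add a :: f); split=> //=; try lia.
    move=> [|c x] y /=; first by split=> // -[[|? ?]].
    split; first by case/andP=> /eqP-> /H [z Hz Hf]; exists (a :: z); rewrite /= eqxx.
    by case=> -[|c' z] //= /andP[/eqP-> Hz] /andP[-> Hf]; apply/H; exists z.
  have [e [f [e1 e2 e3 e4 H]]] := IH i j Hi Hj.
  exists (Drop a :: e), f; split=> //=; try lia.
  move=> [|c x] y /=; first by split=> // -[].
  split; first by case/andP=> /eqP-> /H [z Hz Hf]; exists z => //=; rewrite eqxx.
  by case=> z /andP[-> Hz] Hf; apply/H; exists z.
- case: j => [|j] Hi Hj.
    have [e [f [e1 e2 e3 e4 H]]] := IH i 0 Hi isT.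
    exists (Add b :: e), (Keep :: f); split=> //=; try lia.
    move=> x [|d y] /=; first by split=> // -[[|? ?]].
    split; first by case/andP=> /eqP-> /H [z Hz Hf]; exists (b :: z); rewrite /= eqxx.
    by case=> -[|c' z] //= /andP[/eqP-> Hz] /andP[/eqP<- Hf]; rewrite eqxx; apply/H; exists z.
  have [e [f [e1 e2 e3 e4 H]]] := IH i j Hi Hj.
  exists e, (Drop b :: f); split=> //=; try lia.
  move=> x [|d y] /=; first by split=> // -[].
  split; first by case/andP=> /eqP-> /H [z Hz Hf]; exists z => //=; rewrite eqxx.
  by case=> z Hz /andP[-> Hf]; apply/H; exists z.
Qed.

(** Letters added in front by the first script are exactly those removed by the flipped second one.
    This pads both factors up to a prescribed number of insertions. *)
Lemma relay_nseq_Add (T : eqType) (c : T) n (e f : seq (edit T)) x y :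
  relay (nseq n (Add c) ++ e) (map (@flip T) (nseq n (Add c) ++ f)) x y <->
  relay e (map (@flip T) f) x y.
Proof.
elim: n => //= n IH; rewrite -IH; split=> [[[|d z] //= /andP[_ H] /andP[_ H']]|].
  by exists z.
by case=> z H H'; exists (c :: z); rewrite /= eqxx.
Qed.

Lemma nseq_Add_sizes (T : eqType) (c : T) n (e : seq (edit T)) :
  size (dropped (nseq n (Add c) ++ e)) = size (dropped e) /\
  size (added (nseq n (Add c) ++ e)) = n + size (added e).
Proof. by elim: n => //= n [-> ->]. Qed.

Lemma split_keep T (m : seq (edit T)) : 0 < keeps m ->
  exists m1 m2, m = m1 ++ Keep :: m2.
Proof.
elim: m => //= -[|a|b] m IH.
- by move=> _; exists [::], m.
- by move=> /IH [m1 [m2 ->]]; exists (Drop a :: m1), m2.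
- by move=> /IH [m1 [m2 ->]]; exists (Add b :: m1), m2.
Qed.

(** The resolution of the identity on one tensor factor: only the letter actually kept contributes
    to the sum. It trades a script for scripts with one more drop and one more addition. *)
Lemma runs_split_keep (T : finType) (m1 m2 : seq (edit T)) x y :
  (runs (m1 ++ Keep :: m2) x y : nat) =
  \sum_(c : T) runs (m1 ++ Drop c :: Add c :: m2) x y.
Proof.
elim: m1 x y => [|[|a|b] m IH] [|c x] [|d y] /=; try (by rewrite big1);
  try by case: eqP => //= _; rewrite ?IH // big1.
- by rewrite big1 // => i _; case: eqP.
- rewrite (bigD1 c) //= eqxx /= big1 ?addn0 => [|i ne]; first by rewrite eq_sym.
  by rewrite eq_sym (negbTE ne).
Qed.

Lemma split_keep_sizes (T : eqType) (m1 m2 : seq (edit T)) c :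
  [/\ (keeps (m1 ++ Drop c :: Add c :: m2)).+1 = keeps (m1 ++ Keep :: m2),
      size (dropped (m1 ++ Drop c :: Add c :: m2)) = (size (dropped (m1 ++ Keep :: m2))).+1 &
      size (added (m1 ++ Drop c :: Add c :: m2)) = (size (added (m1 ++ Keep :: m2))).+1].
Proof.
by elim: m1 => [|[|a|b] m1 [H1 H2 H3]] //=; split; lia.
Qed.

(** * Scripts in terms of positions and letters *)

Definition rem_at T (p : nat) (x : seq T) := take p x ++ drop p.+1 x.
(* Removes the last position first, so that for increasing [l] all positions
   refer to the original word. *)
Definition cut T (l : seq nat) (x : seq T) := foldr (@rem_at T) x l.
Definition sel T (d : T) (l : seq nat) (x : seq T) := [seq nth d x p | p <- l].

Arguments rem_at : simpl never.
Arguments cut : simpl never.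
Arguments sel : simpl never.

Lemma sel_map_S T (d c : T) l x : sel d (map S l) (c :: x) = sel d l x.
Proof. by rewrite /sel -map_comp. Qed.

Lemma sel0_map_S T (d c : T) l x : sel d (0 :: map S l) (c :: x) = c :: sel d l x.
Proof. by rewrite -[LHS]/(c :: sel d (map S l) (c :: x)) sel_map_S. Qed.

Lemma cut_map_S T (c : T) l x : cut (map S l) (c :: x) = c :: cut l x.
Proof. by rewrite /cut; elim: l => //= p l ->. Qed.

Lemma cut0_map_S T (c : T) l x : cut (0 :: map S l) (c :: x) = cut l x.
Proof.
by rewrite -[LHS]/(rem_at 0 (cut (map S l) (c :: x))) cut_map_S /rem_at /= drop0.
Qed.

(** Reading off the letters at the edited positions and comparing what is left on both sides tests
    all edits at once. The size conditions exclude words of the wrong length, which [nth] with its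
    default and [cut] would not detect. *)
Lemma runsE (T : eqType) (d : T) (e : seq (edit T)) x z :
  size x = keeps e + size (dropped e) -> size z = keeps e + size (added e) ->
  runs e x z = [&& sel d (drop_pos e) x == dropped e, sel d (add_pos e) z == added e &
                   cut (drop_pos e) x == cut (add_pos e) z].
Proof.
elim: e x z => [|[|a|b] e IH] x z.
- by case: x; case: z.
- case: x z => [|c x] [|f z] //= [sx] [sz].
  rewrite IH // !sel_map_S !cut_map_S eqseq_cons.
  by case: (c == f); rewrite ?andbF ?andbT.
- case: x => [|c x] /=; first by lia.
  rewrite addnS => -[sx] sz.
  by rewrite IH // sel0_map_S cut0_map_S eqseq_cons -!andbA.
- case: z => [|c z] /=; first by lia.
  rewrite addnS => sx [sz].
  rewrite IH // sel0_map_S cut0_map_S eqseq_cons.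
  by case: (c == b); rewrite //= ?andbF.
Qed.

Lemma drop_pos_sorted T (e : seq (edit T)) : sorted ltn (drop_pos e).
Proof.
elim: e => [|[|a|b] e IH] //=.
- by rewrite sorted_map.
- rewrite path_min_sorted; first by rewrite sorted_map.
  by apply/allP => p /mapP[k _ ->].
Qed.

Lemma drop_pos_lt (T : eqType) (e : seq (edit T)) :
  all (gtn (keeps e + size (dropped e))) (drop_pos e).
Proof.
elim: e => [|[|a|b] e IH] //=.
- by rewrite all_map; apply: sub_all IH => p /=; lia.
- rewrite all_map; apply/andP; split; first lia.
  by apply: sub_all IH => p /=; lia.
Qed.

Lemma size_drop_pos T (e : seq (edit T)) : size (drop_pos e) = size (dropped e).
Proof. by elim: e => [|[|a|b] e IH] //=; rewrite ?size_map ?IH. Qed.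

(** The script walks through [n] positions, dropping the next letter of [a] at those in [l] and
    keeping all others. *)
Lemma exists_drops (T : eqType) (n : nat) (l : seq nat) (a : seq T) :
  sorted ltn l -> all (gtn n) l -> size a = size l ->
  exists e : seq (edit T),
    [/\ drop_pos e = l, dropped e = a, add_pos e = [::], added e = [::] &
        keeps e + size a = n].
Proof.
elim: n l a => [|n IH] l a sl al sa.
  case: l al sl sa => //= _ _; case: a => // _; by exists [::].
(* A list avoiding position 0 is the successor image of a list for a word one letter shorter. *)
have shift l' : sorted ltn l' -> all (gtn n.+1) l' -> 0 \notin l' ->
   exists2 l1, l' = map S l1 & sorted ltn l1 /\ all (gtn n) l1.
  move=> s1 a1 n0; have E : l' = map S (map predn l').
    rewrite -map_comp -[LHS]map_id; apply/eq_in_map => -[|p] // p0.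
    by rewrite p0 in n0.
  exists (map predn l') => //; move: s1 a1; rewrite E sorted_map all_map.
  by move=> s1 a1; rewrite -map_comp map_id.
case: (boolP (0 \in l)) => [l0|l0]; last first.
  have [l1 E [s1 a1]] := shift _ sl al l0.
  have sa1 : size a = size l1 by rewrite sa E size_map.
  have [e [e1 e2 e3 e4 e5]] := IH l1 a s1 a1 sa1.
  exists (Keep :: e); split=> //=; rewrite ?e1 ?e3 //; lia.
case: l sl al l0 sa => // p l sl al l0 sa.
have p0 : p = 0.
  move: l0; rewrite inE => /orP[/eqP->//|l0].
  have /allP/(_ 0 l0) := order_path_min ltn_trans sl.
  by [].
subst p; case: a sa => // b a [sa].
have [|||l1 E [s1 a1]] := shift l.
- by apply: path_sorted sl.
- by case/andP: al.
- by apply/negP=> /(allP (order_path_min ltn_trans sl)).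
have sa1 : size a = size l1 by rewrite sa E size_map.
have [e [e1 e2 e3 e4 e5]] := IH l1 a s1 a1 sa1.
exists (Drop b :: e); split=> //=; rewrite ?e1 ?e2 ?E //; lia.
Qed.

(** * Hermitian forms and the recovery criterion *)

Local Open Scope ring_scope.

Section Hermitian.
Variable R : realType.
Local Notation C := (R[i]).
Implicit Types T Z I L : finType.

Definition dot T (u v : T -> C) : C := \sum_x conjc (u x) * v x.

Definition app Z T (E : Z -> T -> C) (v : T -> C) : Z -> C :=
  fun z => \sum_x E z x * v x.

Definition lin_space T (S : (T -> C) -> Prop) : Prop :=
  S (fun _ => 0) /\
  (forall a u v, S u -> S v -> S (fun x => a * u x + v x)).

Definition orthonormal I T (u : I -> T -> C) : Prop :=
  forall i j, dot (u i) (u j) = (i == j)%:R.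

Lemma dotC T (u v : T -> C) : dot v u = conjc (dot u v).
Proof.
rewrite /dot rmorph_sum; apply: eq_bigr => x _.
by rewrite rmorphM /= conjcK mulrC.
Qed.

Lemma dot_sumr T I (a : I -> C) (v : I -> T -> C) u :
  dot u (fun x => \sum_i a i * v i x) = \sum_i a i * dot u (v i).
Proof.
rewrite /dot; under eq_bigr do rewrite mulr_sumr.
rewrite exchange_big; apply: eq_bigr => i _.
by rewrite mulr_sumr; apply: eq_bigr => x _; rewrite mulrCA.
Qed.

Lemma dot_suml T I (a : I -> C) (v : I -> T -> C) u :
  dot (fun x => \sum_i a i * v i x) u = \sum_i conjc (a i) * dot (v i) u.
Proof.
rewrite dotC dot_sumr rmorph_sum; apply: eq_bigr => i _.
by rewrite rmorphM /= -dotC.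
Qed.

Lemma dot_linr T a b (u v w : T -> C) :
  dot u (fun x => a * v x + b * w x) = a * dot u v + b * dot u w.
Proof.
rewrite /dot !mulr_sumr -big_split; apply: eq_bigr => x _ /=.
by rewrite mulrDr !(mulrCA (conjc _)).
Qed.

Lemma dot_linl T a b (u v w : T -> C) :
  dot (fun x => a * v x + b * w x) u = conjc a * dot v u + conjc b * dot w u.
Proof. by rewrite dotC dot_linr rmorphD !rmorphM /= -!dotC. Qed.

Lemma dotBr T (u v w : T -> C) : dot u (fun x => v x - w x) = dot u v - dot u w.
Proof.
rewrite -[RHS](_ : 1 * dot u v + (-1) * dot u w = _); last by rewrite mul1r mulN1r.
by rewrite -dot_linr; congr dot; apply/funext => x; rewrite mul1r mulN1r.
Qed.

Lemma mulconjc_ge0 (z : C) : 0 <= conjc z * z.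
Proof. by rewrite mulrC -sqr_normc exprn_ge0. Qed.

Lemma mulconjc_eq0 (z : C) : (conjc z * z == 0) = (z == 0).
Proof. by rewrite mulrC -sqr_normc sqrf_eq0 normr_eq0. Qed.

Lemma dot_ge0 T (u : T -> C) : 0 <= dot u u.
Proof. by apply: sumr_ge0 => x _; apply: mulconjc_ge0. Qed.

Lemma dot_eq0 T (u : T -> C) : dot u u = 0 -> forall x, u x = 0.
Proof.
move=> /eqP; rewrite psumr_eq0 => [/allP H x|x _]; last exact: mulconjc_ge0.
by have := H x (mem_index_enum _); rewrite mulconjc_eq0 => /eqP.
Qed.

Lemma lin_space_sum T I (S : (T -> C) -> Prop) (a : I -> C) (u : I -> T -> C) :
  lin_space S -> (forall i, S (u i)) -> S (fun x => \sum_i a i * u i x).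
Proof.
move=> [S0 SD] Su.
suff H (r : seq I) : S (fun x => \sum_(i <- r) a i * u i x) by exact: H.
elim: r => [|i r IH].
  by rewrite [X in S X](_ : _ = fun=> 0) //; apply/funext => x; rewrite big_nil.
rewrite [X in S X](_ : _ = fun x => a i * u i x + \sum_(j <- r) a j * u j x).
  exact: SD.
by apply/funext => x; rewrite big_cons.
Qed.

(** The Gram matrix factors as an [n] by [#|T|] matrix times a [#|T|] by [n] matrix, and the product
    is the identity. *)
Lemma orthonormal_leq T n (u : 'I_n -> T -> C) : orthonormal u -> (n <= #|T|)%N.
Proof.
move=> Hu.
apply: (@mulmx1_min _ _ _ (\matrix_(i, j) conjc (u i (enum_val j)))
   (\matrix_(j, i) u i (enum_val j))).
apply/matrixP => i j; rewrite !mxE -Hu /dot.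
under eq_bigr do rewrite !mxE.
by rewrite (big_enum_val (fun x => conjc (u i x) * u j x)).
Qed.

Lemma dot_normalize T (v : T -> C) : dot v v != 0 ->
  exists a : C, dot (fun x => a * v x) (fun x => a * v x) = 1.
Proof.
move=> vv0; have vv := dot_ge0 v.
have rE : (complex.Re (dot v v))%:C%C = dot v v.
  by apply: RRe_real; rewrite ger0_real.
set r := complex.Re _ in rE.
have r0 : 0 < r by rewrite -ltcR rE lt_neqAle eq_sym vv0.
exists ((Num.sqrt r)^-1%:C%C).
rewrite -[LHS](_ : conjc ((Num.sqrt r)^-1%:C%C) * ((Num.sqrt r)^-1%:C%C * dot v v) = _).
  rewrite conjc_real mulrA -rE -!rmorphM -expr2 exprVn sqr_sqrtr ?ltW //.
  by rewrite mulVf ?gt_eqF.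
rewrite /dot !mulr_sumr; apply: eq_bigr => x _.
by rewrite rmorphM /=; ring.
Qed.

(** As [S] is a mere predicate, the basis is taken as an orthonormal family in [S] of maximal size.
    A vector with nonzero residual [w] would, after normalisation, extend it. *)
Lemma orthonormal_basis T (S : (T -> C) -> Prop) : lin_space S ->
  exists n (u : 'I_n -> T -> C), [/\ orthonormal u, forall i, S (u i) &
    forall v, S v -> forall x, v x = \sum_i dot (u i) v * u i x].
Proof.
move=> Ssp; have [S0 SD] := Ssp.
pose P n := `[< exists u : 'I_n -> T -> C, orthonormal u /\ forall i, S (u i) >].
have exP : exists n, P n.
  exists 0%N; apply/asboolP; exists (fun _ _ => 0); split; by case.
have ubP n : P n -> (n <= #|T|)%N.
  by move=> /asboolP[u [Hu _]]; apply: orthonormal_leq Hu.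
case: (ex_maxnP exP ubP) => n /asboolP[u [Hu Su]] maxn.
exists n, u; split=> // v Sv.
pose w x := v x - \sum_i dot (u i) v * u i x.
have uw i : dot (u i) w = 0.
  rewrite /w dotBr dot_sumr (bigD1 i) //= Hu eqxx mulr1 big1 ?addr0 ?subrr // => j ne.
  by rewrite Hu eq_sym (negbTE ne) mulr0.
have Sw : S w.
  rewrite [w](_ : _ = fun x => (-1) * (\sum_i dot (u i) v * u i x) + v x).
    by apply: SD => //; apply: lin_space_sum.
  by apply/funext => x; rewrite mulN1r addrC.
case: (eqVneq (dot w w) 0) => [/dot_eq0 w0 x|/dot_normalize [a aw]].
  by apply/eqP; rewrite -subr_eq0; apply/eqP; apply: w0.
suff /maxn : P n.+1 by rewrite ltnn.
have uaw i : dot (u i) (fun x => a * w x) = 0.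
  rewrite [X in dot _ X](_ : _ = fun x => a * w x + 0 * w x).
    by rewrite dot_linr uw !mulr0 addr0.
  by apply/funext => x; rewrite mul0r addr0.
apply/asboolP; exists (fun i => if unlift ord_max i is Some j then u j
                                else fun x => a * w x); split.
  move=> i j; case: unliftP => [i'|] ->; case: unliftP => [j'|] ->.
  - by rewrite Hu (inj_eq lift_inj).
  - by rewrite uaw eq_sym (negbTE (neq_lift _ _)).
  - by rewrite dotC uaw rmorph0 (negbTE (neq_lift _ _)).
  - by rewrite aw eqxx.
move=> i; case: unliftP => [i'|] _ //.
rewrite [X in S X](_ : _ = fun x => a * w x + 0); first exact: SD.
by apply/funext => x; rewrite addr0.
Qed.

(** The family [h] is a basis of the orthogonal complement of [w]; the completeness relation is the
    expansion of the basis vector at [z']. *)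
Lemma orthonormal_complete I Z (w : I -> Z -> C) : orthonormal w ->
  exists n (h : 'I_n -> Z -> C), (forall i j, dot (h j) (w i) = 0) /\
    forall z z', \sum_i w i z * conjc (w i z') + \sum_j h j z * conjc (h j z')
                 = (z == z')%:R.
Proof.
move=> Hw.
have [|n [h [Hh Sh h_span]]] :=
    @orthonormal_basis Z (fun v => forall i, dot (w i) v = 0).
  split=> [i|a u v Hu Hv i]; first by rewrite /dot big1 // => x _; rewrite mulr0.
  rewrite [X in dot _ X](_ : _ = fun x => a * u x + 1 * v x).
    by rewrite dot_linr Hu Hv !mulr0 addr0.
  by apply/funext => x; rewrite mul1r.
exists n, h; split=> [i j|z z']; first by rewrite dotC Sh rmorph0.
pose v x : C := (x == z')%:R.
have dv u : dot u v = conjc (u z').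
  rewrite /dot (bigD1 z') //= /v eqxx mulr1 big1 ?addr0 // => x ne.
  by rewrite (negbTE ne) mulr0.
pose v' x := v x - \sum_i dot (w i) v * w i x.
have v'S i : dot (w i) v' = 0.
  rewrite dotBr dot_sumr (bigD1 i) //= Hw eqxx mulr1 big1 ?addr0 ?subrr // => j ne.
  by rewrite Hw eq_sym (negbTE ne) mulr0.
have := h_span v' v'S z; rewrite {1}/v' => /eqP; rewrite subr_eq => /eqP.
rewrite -/(v z) => ->; rewrite addrC; congr +%R.
  apply: eq_bigr => j _; rewrite mulrC dotBr dot_sumr big1 ?subr0 ?dv // => i _.
  by rewrite (dotC (w i) (h j)) Sh rmorph0 mulr0.
by apply: eq_bigr => i _; rewrite dv mulrC.
Qed.

Lemma app_sum Z T I (E : Z -> T -> C) (a : I -> C) (v : I -> T -> C) z :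
  app E (fun x => \sum_i a i * v i x) z = \sum_i a i * app E (v i) z.
Proof.
rewrite /app; under eq_bigr do rewrite mulr_sumr.
rewrite exchange_big; apply: eq_bigr => i _.
by rewrite mulr_sumr; apply: eq_bigr => x _; rewrite mulrCA.
Qed.

Lemma app_lin Z T (E : Z -> T -> C) a b (u v : T -> C) :
  app E (fun x => a * u x + b * v x) = fun z => a * app E u z + b * app E v z.
Proof.
apply/funext => z; rewrite /app !mulr_sumr -big_split; apply: eq_bigr => x _ /=.
by rewrite mulrDr !(mulrCA (E _ _)).
Qed.

End Hermitian.

(** * From orthogonality to a recovery channel *)

Section KnillLaflamme.
Variable R : realType.
Local Notation C := (R[i]).
Implicit Types T Z I L : finType.

Lemma sum_pair I L (F : I * L -> C) : \sum_p F p = \sum_i \sum_j F (i, j).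
Proof. by rewrite pair_bigA; apply: eq_bigr => -[]. Qed.

(** The vectors [u 0 + u i] and [u 0 - u i] are orthogonal. Since the mixed terms vanish,
    orthogonality of their images says that the diagonal terms at [0] and [i] agree. *)
Lemma orthogonality_transfer T Z (S : (T -> C) -> Prop) (E F : Z -> T -> C) :
  lin_space S ->
  (forall u v, S u -> S v -> dot u v = 0 -> dot (app E u) (app F v) = 0) ->
  forall n (u : 'I_n.+1 -> T -> C), orthonormal u -> (forall i, S (u i)) ->
  forall i j, dot (app E (u i)) (app F (u j)) =
              (i == j)%:R * dot (app E (u ord0)) (app F (u ord0)).
Proof.
move=> [S0 SD] H n u Hu Su i j.
case: (eqVneq i j) => [<-|ne]; last by rewrite mul0r H ?Hu ?(negbTE ne).
rewrite mul1r; case: (eqVneq ord0 i) => [<-//|ne].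
have Sc a : S (fun x => 1 * u ord0 x + a * u i x).
  rewrite [X in S X](_ : _ = fun x => a * u i x + u ord0 x); first exact: SD.
  by apply/funext => x; rewrite mul1r addrC.
have := H _ _ (Sc 1) (Sc (-1)).
rewrite !app_lin !dot_linl !dot_linr !Hu !eqxx [i == ord0]eq_sym (negbTE ne) !rmorph1.
rewrite !mulr0 !mulr1 !add0r !addr0 !mul1r subrr => /(_ erefl).
rewrite (H (u ord0) (u i)) ?Hu ?(negbTE ne) // (H (u i) (u ord0)) ?Hu ?[i == _]eq_sym ?(negbTE ne) //.
by rewrite mulr0 addr0 add0r mulN1r => /eqP; rewrite subr_eq0 => /eqP.
Qed.

(* The operators [E l], restricted to [S], factor as [v |-> m_l (x) v] through an
   isometric copy [w k i] of [K (x) S], where [K] is the span of the [E l (u 0)]. *)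
Lemma orthogonality_recovery T Z L (x0 : T) (S : (T -> C) -> Prop)
    (E : L -> Z -> T -> C) :
  lin_space S ->
  (forall l m u v, S u -> S v -> dot u v = 0 ->
     dot (app (E l) u) (app (E m) v) = 0) ->
  exists (I : finType) (K : I -> T -> Z -> C) (mu : I -> L -> C),
    (forall z z', \sum_i \sum_x conjc (K i x z) * K i x z' = (z == z')%:R) /\
    (forall i l v, S v -> forall x, app (K i) (app (E l) v) x = mu i l * v x).
Proof.
move=> Ssp HE; have [n [u [Hu Su u_span]]] := orthonormal_basis Ssp.
suff [s [w [mu [Hw HwE]]]] : exists s (w : 'I_s * 'I_n -> Z -> C) (mu : 'I_s -> L -> C),
    orthonormal w /\
    forall l i z, app (E l) (u i) z = \sum_k mu k l * w (k, i) z.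
  have [r [h [hw h_complete]]] := orthonormal_complete Hw.
  (* The operators [inl k] send [w (k, i)] back to [u i], discarding [k]. The operators [inr j] send
     the remaining directions [h j] to the basis vector at [x0], an arbitrary choice that makes the
     family trace preserving. *)
  pose K (c : 'I_s + 'I_r) x z := match c with
    | inl k => \sum_i u i x * conjc (w (k, i) z)
    | inr j => (x == x0)%:R * conjc (h j z)
    end.
  exists ('I_s + 'I_r)%type, K, (fun c l => if c is inl k then mu k l else 0).
  have appE l v z : S v ->
      app (E l) v z = \sum_(ki : 'I_s * 'I_n) (mu ki.1 l * dot (u ki.2) v) * w ki z.
    move=> Sv; transitivity (app (E l) (fun x => \sum_i dot (u i) v * u i x) z).
      by apply: eq_bigr => x _; rewrite -u_span.
    rewrite app_sum; under eq_bigr do rewrite HwE mulr_sumr.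
    rewrite exchange_big /= sum_pair.
    by apply: eq_bigr => k _; apply: eq_bigr => i _; ring.
  split=> [z z'|c l v Sv x].
    rewrite -h_complete big_sumType /= addrC [RHS]addrC; congr +%R.
      apply: eq_bigr => j _; rewrite (bigD1 x0) //= eqxx !mul1r conjcK big1 ?addr0 // => x ne.
      by rewrite (negbTE ne) !mul0r mulr0.
    rewrite sum_pair.
    apply: eq_bigr => k _.
    transitivity (dot (fun x => \sum_i conjc (w (k, i) z) * u i x)
                      (fun x => \sum_i conjc (w (k, i) z') * u i x)).
      apply: eq_bigr => x _; congr (conjc _ * _);
      by apply: eq_bigr => i _; rewrite mulrC.
    rewrite dot_suml; apply: eq_bigr => i _; rewrite dot_sumr conjcK.
    rewrite (bigD1 i) //= Hu eqxx mulr1 big1 ?addr0 // => j ne.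
    by rewrite Hu eq_sym (negbTE ne) mulr0.
  have -> : app (E l) v = fun z => \sum_(ki : 'I_s * 'I_n) (mu ki.1 l * dot (u ki.2) v) * w ki z.
    by apply/funext => z; rewrite appE.
  case: c => [k|j] /=.
    transitivity (\sum_i u i x * dot (w (k, i))
        (fun z => \sum_(ki : 'I_s * 'I_n) (mu ki.1 l * dot (u ki.2) v) * w ki z)).
      rewrite /app /K; under eq_bigr do rewrite mulr_suml.
      rewrite exchange_big /=; apply: eq_bigr => i _; rewrite /dot mulr_sumr.
      by apply: eq_bigr => z _; rewrite mulrA.
    rewrite (u_span v Sv) mulr_sumr; apply: eq_bigr => i _.
    rewrite dot_sumr (bigD1 (k, i)) //= Hw eqxx mulr1 big1 ?addr0 => [|p ne]; first by ring.
    by rewrite Hw eq_sym (negbTE ne) mulr0.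
  rewrite mul0r.
  transitivity ((x == x0)%:R * dot (h j)
      (fun z => \sum_(ki : 'I_s * 'I_n) (mu ki.1 l * dot (u ki.2) v) * w ki z)).
    by rewrite /app /dot mulr_sumr; apply: eq_bigr => z _; rewrite mulrA.
  by rewrite dot_sumr big1 ?mulr0 // => ki _; rewrite hw mulr0.
case: n u Hu Su u_span => [|n] u Hu Su u_span.
  exists 0%N, (fun _ _ => 0), (fun _ _ => 0); split; first by case=> -[].
  by move=> l [].
have tr l m := orthogonality_transfer Ssp (HE l m) Hu Su.
(* By [tr], combinations at different [i] are orthogonal and inner products at the same [i] do not
   depend on [i]. So [comb a ord0 |-> comb a i] is a well-defined isometry, and an orthonormal basis
   chosen at [ord0] can be carried to every [i]. *)
pose comb (a : L -> C) i : Z -> C := fun z => \sum_l a l * app (E l) (u i) z.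
have dot_comb a b i j : dot (comb a i) (comb b j) = (i == j)%:R * dot (comb a ord0) (comb b ord0).
  rewrite /comb !dot_suml mulr_sumr; apply: eq_bigr => l _.
  rewrite !dot_sumr !mulr_sumr; apply: eq_bigr => m _; rewrite tr; ring.
have [|s [g [Hg Sg g_span]]] := @orthonormal_basis R Z (fun v => exists a, v = comb a ord0).
  split=> [|a _ _ [b ->] [c ->]].
    by exists (fun=> 0); apply/funext => z; rewrite /comb big1 // => l _; rewrite mul0r.
  exists (fun l => a * b l + c l); apply/funext => z; rewrite /comb mulr_sumr -big_split.
  by apply: eq_bigr => l _ /=; ring.
have [a ga] := choice Sg.
pose mu k l := dot (g k) (app (E l) (u ord0)).
exists s, (fun p => comb (a p.1) p.2), mu; split=> [[k i] [k' j]|l i z] /=.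
  by rewrite dot_comb -!ga Hg -natrM mulnb andbC -xpair_eqE.
(* Coefficients of [E l] minus its expansion in the basis [g]. The combination vanishes at [ord0],
   hence by the isometry at every [i]. *)
pose b m := (m == l)%:R - \sum_k mu k l * a k m.
have bE j z' : comb b j z' = app (E l) (u j) z' - \sum_k mu k l * comb (a k) j z'.
  rewrite /comb /b; under eq_bigr do rewrite mulrBl.
  rewrite sumrB (bigD1 l) //= eqxx mul1r big1 ?addr0; last first.
    by move=> m ne; rewrite (negbTE ne) mul0r.
  congr (_ - _); under eq_bigr do rewrite mulr_suml.
  rewrite exchange_big /=; apply: eq_bigr => k _; rewrite mulr_sumr.
  by apply: eq_bigr => m _; rewrite mulrA.
have b0 : comb b ord0 = fun=> 0.
  apply/funext => z'; rewrite bE; apply/eqP; rewrite subr_eq0; apply/eqP.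
  rewrite g_span; first by apply: eq_bigr => k _; rewrite -ga.
  exists (fun m => (m == l)%:R); apply/funext => z1.
  rewrite /comb (bigD1 l) //= eqxx mul1r big1 ?addr0 // => m ne.
  by rewrite (negbTE ne) mul0r.
have /dot_eq0/(_ z) : dot (comb b i) (comb b i) = 0.
  by rewrite dot_comb b0 /dot big1 ?mulr0 // => z' _; rewrite mulr0.
by rewrite bE => /eqP; rewrite subr_eq0 => /eqP.
Qed.

Definition kraus_map Z T I (K : I -> T -> Z -> C) (X : Z -> Z -> C) : T -> T -> C :=
  fun x y => \sum_i \sum_z \sum_z' K i x z * X z z' * conjc (K i y z').

Lemma psd_sum T I (A : I -> T -> T -> C) :
  (forall i, psd (A i)) -> psd (fun x y => \sum_i A i x y).
Proof.
move=> HA; split=> [x y|v].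
  by rewrite rmorph_sum; apply: eq_bigr => i _; apply: (HA i).1.
rewrite -[X in 0 <= X](_ : \sum_i \sum_x \sum_y conjc (v x) * A i x y * v y = _).
  by apply: sumr_ge0 => i _; apply: (HA i).2.
rewrite exchange_big; apply: eq_bigr => x _ /=.
rewrite exchange_big; apply: eq_bigr => y _ /=.
by rewrite mulr_sumr mulr_suml.
Qed.

Lemma psd_sandwich Z T (A : Z -> Z -> C) (B : T -> Z -> C) : psd A ->
  psd (fun x y => \sum_z \sum_z' B x z * A z z' * conjc (B y z')).
Proof.
move=> [hA pA]; split=> [x y|v].
  rewrite exchange_big rmorph_sum; apply: eq_bigr => z _ /=.
  rewrite rmorph_sum; apply: eq_bigr => z' _ /=.
  by rewrite !rmorphM /= conjcK -hA; ring.
pose w z := \sum_y conjc (B y z) * v y.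
rewrite -[X in 0 <= X](_ : \sum_z \sum_z' conjc (w z) * A z z' * w z' = _) //.
transitivity (\sum_z \sum_z' \sum_x \sum_y
    conjc (v x) * (B x z * A z z' * conjc (B y z')) * v y).
  apply: eq_bigr => z _; apply: eq_bigr => z' _.
  rewrite /w rmorph_sum /= !mulr_suml; apply: eq_bigr => x _.
  rewrite mulr_sumr; apply: eq_bigr => y _.
  by rewrite rmorphM /= conjcK; ring.
under eq_bigr do rewrite exchange_big /=.
rewrite exchange_big /=; apply: eq_bigr => x _.
under eq_bigr do rewrite exchange_big /=.
rewrite exchange_big /=; apply: eq_bigr => y _.
rewrite mulr_sumr mulr_suml; apply: eq_bigr => z _.
by rewrite mulr_sumr mulr_suml.
Qed.

Lemma kraus_map_channel q m n I (K : I -> idx q n -> idx q m -> C) :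
  (forall z z', \sum_i \sum_x conjc (K i x z) * K i x z' = (z == z')%:R) ->
  quantum_channel (kraus_map K : op R q m -> op R q n).
Proof.
move=> HK; split.
- move=> a A B; apply/funext => x; apply/funext => y; rewrite /kraus_map.
  rewrite mulr_sumr -big_split; apply: eq_bigr => i _ /=.
  rewrite mulr_sumr -big_split; apply: eq_bigr => z _ /=.
  rewrite mulr_sumr -big_split; apply: eq_bigr => z' _ /=.
  by ring.
- move=> k X psdX.
  (* The ancilla is untouched: each term is the conjugation of [X] by the identity tensored with
     [K i], the identity being the Kronecker delta. *)
  rewrite [X in psd X](_ : _ = fun u v : 'I_k * idx q n => \sum_i \sum_z \sum_z'
     ((u.1 == z.1)%:R * K i u.2 z.2) * X z z' * conjc ((v.1 == z'.1)%:R * K i v.2 z'.2)).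
    apply: psd_sum => i.
    exact: (psd_sandwich
      (fun (u : 'I_k * idx q n) (z : 'I_k * idx q m) => (u.1 == z.1)%:R * K i u.2 z.2)).
  apply/funext => -[a x]; apply/funext => -[b y] /=; apply: eq_bigr => i _.
  pose F (c : 'I_k) z (d : 'I_k) z' := (a == c)%:R * K i x z * X (c, z) (d, z') *
      conjc ((b == d)%:R * K i y z').
  transitivity (\sum_c \sum_z \sum_d \sum_z' F c z d z'); last first.
    rewrite sum_pair; apply: eq_bigr => c _; apply: eq_bigr => z _.
    by rewrite sum_pair.
  rewrite (bigD1 a) //= [X in _ + X]big1 ?addr0; last first.
    move=> c ne; rewrite big1 // => z _; rewrite big1 // => d _; rewrite big1 // => z' _.
    by rewrite /F eq_sym (negbTE ne) !mul0r.
  apply: eq_bigr => z _; rewrite (bigD1 b) //= [X in _ + X]big1 ?addr0; last first.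
    move=> c ne; rewrite big1 // => z' _.
    by rewrite /F (eq_sym b) (negbTE ne) mul0r conjc0 mulr0.
  by apply: eq_bigr => z' _; rewrite /F !eqxx !mul1r.
- move=> A; rewrite /mtrace /kraus_map.
  transitivity (\sum_z \sum_z' A z z' * (z' == z)%:R).
    under [RHS]eq_bigr do under eq_bigr do rewrite -HK mulr_sumr.
    rewrite exchange_big /=; under eq_bigr do rewrite exchange_big /=.
    rewrite exchange_big /=; apply: eq_bigr => z _.
    under eq_bigr do rewrite exchange_big /=.
    rewrite exchange_big /=; apply: eq_bigr => z' _.
    apply: eq_bigr => i _; rewrite mulr_sumr; apply: eq_bigr => x _; ring.
  apply: eq_bigr => z _; rewrite (bigD1 z) //= eqxx mulr1 big1 ?addr0 // => z' ne.
  by rewrite (negbTE ne) mulr0.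
Qed.

End KnillLaflamme.

(** * From a recovery channel to orthogonality *)

Section Necessity.
Variable R : realType.
Local Notation C := (R[i]).
Implicit Types T Z I L : finType.

Lemma conjc_ge0 (a : C) : 0 <= a -> conjc a = a.
Proof. by move=> a0; rewrite -(RRe_real (ger0_real a0)) conjc_real. Qed.

Lemma psdE T (A : T -> T -> C) : psd A -> forall v, 0 <= dot v (app A v).
Proof.
move=> [_ pA] v; have := pA v; congr (0 <= _).
apply: eq_bigr => x _; rewrite mulr_sumr; apply: eq_bigr => y _.
by rewrite mulrA.
Qed.

Lemma psd_adjoint T (A : T -> T -> C) u v : psd A ->
  dot u (app A v) = conjc (dot v (app A u)).
Proof.
move=> [hA _]; rewrite /dot /app rmorph_sum /=.
under eq_bigr do rewrite mulr_sumr.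
under [RHS]eq_bigr do rewrite mulr_sumr rmorph_sum /=.
rewrite exchange_big; apply: eq_bigr => y _; apply: eq_bigr => x _.
by rewrite !rmorphM /= conjcK -hA; ring.
Qed.

(** With [w = A z], [b = dot w w] and [c = dot w (A w)], the form at [t z + w] equals [2 t b + c]
    for real [t]. If [b > 0], the value [t = - (c + 1) / b] makes it [- (c + 2)], which is
    negative. *)
Lemma psd_kernel T (A : T -> T -> C) z : psd A -> dot z (app A z) = 0 ->
  forall x, app A z x = 0.
Proof.
move=> pA z0; apply: dot_eq0; set w := app A z; set b := dot w w.
have b0 : 0 <= b := dot_ge0 w.
pose c := dot w (app A w); have c0 : 0 <= c := psdE pA w.
apply/eqP; apply: contraT => bn0.
have bp : 0 < b by rewrite lt_neqAle eq_sym bn0.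
pose t := - ((c + 1) / b).
have tt : conjc t = t.
  rewrite /t rmorphN /= (@conjc_ge0 ((c + 1) / b)) //.
  by rewrite divr_ge0 // addr_ge0.
have := psdE pA (fun x => t * z x + 1 * w x).
rewrite app_lin !dot_linl !dot_linr z0 -/w -/c -/b tt (psd_adjoint z w pA) -/w -/b.
rewrite (conjc_ge0 b0) rmorph1 !mul1r mulr0 add0r addrA -mulrDr.
have -> : t * (b + b) + c = - (c + 2).
  by rewrite /t; field.
rewrite oppr_ge0 => /(lt_le_trans _) - /(_ 0); rewrite ltxx; apply.
by rewrite ltr_wpDl.
Qed.

Lemma psd_outer T (a : T -> C) : psd (fun x y => a x * conjc (a y)).
Proof.
split=> [x y|v]; first by rewrite rmorphM /= conjcK mulrC.
rewrite -[X in 0 <= X](_ : conjc (dot a v) * dot a v = _); first exact: mulconjc_ge0.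
rewrite -dotC /dot mulr_suml; apply: eq_bigr => x _.
by rewrite mulr_sumr; apply: eq_bigr => y _; ring.
Qed.

Lemma linear_op_sum q m n L (Phi : op R q m -> op R q n) (a : L -> C) (A : L -> op R q m) :
  linear_op Phi ->
  Phi (fun x y => \sum_l a l * A l x y) = fun x y => \sum_l a l * Phi (A l) x y.
Proof.
move=> lin.
suff H (r : seq L) : Phi (fun x y => \sum_(l <- r) a l * A l x y) =
    fun x y => \sum_(l <- r) a l * Phi (A l) x y by exact: H.
elim: r => [|l r IH].
  (* [linear_op] at [a = -1] and zero operators gives [Phi 0 = - Phi 0 + Phi 0], so [Phi 0 = 0]. *)
  have := lin (-1) (fun _ _ => 0) (fun _ _ => 0).
  set L0 := Phi _; set L1 := Phi _.
  have -> : L0 = L1.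
    by congr Phi; apply/funext => x; apply/funext => y; rewrite mulr0 addr0.
  rewrite (_ : Phi _ = L1); last first.
    by congr Phi; apply/funext => x; apply/funext => y; rewrite big_nil.
  move=> ->; apply/funext => x; apply/funext => y.
  by rewrite big_nil mulN1r addNr.
rewrite [X in Phi X](_ : _ = fun x y => a l * A l x y + \sum_(j <- r) a j * A j x y).
  rewrite lin IH; apply/funext => x; apply/funext => y.
  by rewrite big_cons.
by apply/funext => x; apply/funext => y; rewrite big_cons.
Qed.

Lemma channel_outer_psd q m n (Phi : op R q m -> op R q n) (a : vec R q m) :
  completely_positive Phi -> psd (Phi (fun x y => a x * conjc (a y))).
Proof.
move=> cp.
have [h p] := cp 1%N _ (psd_outer (fun u : 'I_1 * idx q m => a u.2)).
split=> [x y|v]; first exact: (h (ord0, x) (ord0, y)).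
have := p (fun u => v u.2); rewrite sum_pair big_ord1; congr (0 <= _).
by apply: eq_bigr => x _; rewrite sum_pair big_ord1.
Qed.

(* Complete positivity with a two-dimensional ancilla: the blocks of the image of
   the projector on [E l u (+) E m v] force its off-diagonal block to be a multiple
   of [u v^*], which has trace [0]. *)
Lemma recovery_orthogonality q N M L (S : vec R q N -> Prop)
    (Rec : op R q M -> op R q N) (Phi : op R q N -> op R q M) (c : C)
    (E : L -> idx q M -> idx q N -> C) :
  0 < c -> lin_space S -> quantum_channel Rec ->
  (forall rho z z', Phi rho z z' =
     c * \sum_l \sum_x \sum_y E l z x * rho x y * conjc (E l z' y)) ->
  (forall rho, density rho -> supported_on S rho -> Rec (Phi rho) = rho) ->
  forall l m u v, S u -> S v -> dot u v = 0 ->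
    dot (app (E l) u) (app (E m) v) = 0.
Proof.
move=> c0 Ssp [lin cp tp] PhiE recov.
pose outer (a : vec R q M) : op R q M := fun x y => a x * conjc (a y).
(* Recovery of the normalised projector on [u] writes [dot w (rho w) = 0] as a sum over all labels
   of nonnegative terms with positive weight, so each term vanishes. *)
have null l u w : S u -> dot u u != 0 -> dot u w = 0 ->
    dot w (app (Rec (outer (app (E l) u))) w) = 0.
  move=> Su uu0 uw; pose a := (dot u u)^-1.
  have a0 : 0 < a by rewrite invr_gt0 lt_neqAle eq_sym uu0 dot_ge0.
  pose rho : op R q N := fun x y => a * (u x * conjc (u y)).
  have rhoE w' x : app rho w' x = a * dot u w' * u x.
    rewrite /app /dot mulr_sumr mulr_suml; apply: eq_bigr => y _; rewrite /rho; ring.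
  have drho : density rho.
    split; last first.
      rewrite /mtrace /rho -mulr_sumr -[X in _ * X](_ : dot u u = _) ?mulVf //.
      by apply: eq_bigr => x _; rewrite mulrC.
    have [h p] := psd_outer u; split=> [x y|w'].
      by rewrite /rho h [RHS]rmorphM /= (conjc_ge0 (ltW a0)).
    rewrite -[X in 0 <= X](_ : a * (\sum_x \sum_y conjc (w' x) * (u x * conjc (u y)) * w' y) = _).
      by rewrite mulr_ge0 // ltW.
    rewrite mulr_sumr; apply: eq_bigr => x _; rewrite mulr_sumr; apply: eq_bigr => y _.
    by rewrite /rho; ring.
  have srho : supported_on S rho.
    move=> w'; rewrite [X in S X](_ : _ = fun x => a * dot u w' * u x + 0).
      by apply: Ssp.2 => //; apply: Ssp.1.
    by apply/funext => x; rewrite addr0 -rhoE.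
  have E1 : Phi rho = fun z z' => \sum_l (c * a) * outer (app (E l) u) z z'.
    apply/funext => z; apply/funext => z'; rewrite PhiE mulr_sumr.
    apply: eq_bigr => k _; rewrite -mulrA; congr (_ * _).
    rewrite /outer /app rmorph_sum /= mulr_suml mulr_sumr; apply: eq_bigr => x _.
    rewrite mulr_sumr mulr_sumr; apply: eq_bigr => y _.
    by rewrite rmorphM /= /rho; ring.
  have E2 := recov rho drho srho; rewrite E1 linear_op_sum // in E2.
  have : \sum_k (c * a) * dot w (app (Rec (outer (app (E k) u))) w) = 0.
    transitivity (dot w (app rho w)); last first.
      by rewrite /dot big1 // => x _; rewrite rhoE uw mulr0 mul0r mulr0.
    rewrite -E2 -dot_sumr; apply: eq_bigr => x _; congr (_ * _).
    rewrite /app; under eq_bigr do rewrite mulr_sumr.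
    rewrite exchange_big /=; apply: eq_bigr => y _.
    by rewrite mulr_suml; apply: eq_bigr => k _; rewrite mulrA.
  have ca0 : 0 < c * a by rewrite mulr_gt0.
  move/eqP; rewrite psumr_eq0 => [/allP/(_ l (mem_index_enum _))|k _].
    by rewrite mulf_eq0 (gt_eqF ca0) => /eqP.
  by rewrite mulr_ge0 ?(ltW ca0) //; apply: psdE; apply: channel_outer_psd.
move=> l m u v Su Sv uv.
have zero k w a : dot w w = 0 -> dot (app (E k) w) a = 0.
  move=> /dot_eq0 w0; rewrite /dot big1 // => x _.
  by rewrite /app big1 ?rmorph0 ?mul0r // => y _; rewrite w0 mulr0.
case: (eqVneq (dot u u) 0) => [/zero->//|uu0].
case: (eqVneq (dot v v) 0) => [/zero vz|vv0]; first by rewrite dotC vz rmorph0.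
set al := app (E l) u; set be := app (E m) v.
pose W (p : 'I_2 * idx q M) := if p.1 == ord0 then al p.2 else be p.2.
pose Y (p p' : 'I_2 * idx q N) :=
  Rec (fun x y => W (p.1, x) * conjc (W (p'.1, y))) p.2 p'.2.
have psdY : psd Y by apply: cp (psd_outer W).
(* A vector with zero expectation in the diagonal block [i], extended by zero to the other block,
   lies in the kernel of the whole of [Y]; it therefore also kills the off-diagonal block in that
   column. *)
have Ykernel (i : 'I_2) w : dot w (app (fun x y => Y (i, x) (i, y)) w) = 0 ->
    forall b x, \sum_y Y (b, x) (i, y) * w y = 0.
  move=> w0 b x; pose z (p : 'I_2 * idx q N) := (p.1 == i)%:R * w p.2.
  have appz p : app Y z p = \sum_y Y p (i, y) * w y.
    rewrite /app sum_pair (bigD1 i) //= [X in _ + X]big1 ?addr0; last first.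
      by move=> j ne; rewrite big1 // => y _; rewrite /z (negbTE ne) mul0r mulr0.
    by apply: eq_bigr => y _; rewrite /z eqxx mul1r.
  rewrite -appz; apply: psd_kernel => //.
  rewrite -[RHS]w0 /dot sum_pair (bigD1 i) //= [X in _ + X]big1 ?addr0; last first.
    by move=> j ne; rewrite big1 // => y _; rewrite /z (negbTE ne) mul0r rmorph0 mul0r.
  by apply: eq_bigr => y _; rewrite appz /z eqxx mul1r.
pose i1 : 'I_2 := lift ord0 ord0.
have ker0 w : dot u w = 0 -> forall b x, \sum_y Y (b, x) (ord0, y) * w y = 0.
  by move=> uw; apply: Ykernel; apply: (null l).
have ker1 w : dot v w = 0 -> forall b x, \sum_y Y (b, x) (i1, y) * w y = 0.
  by move=> vw; apply: Ykernel; apply: (null m).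
suff : mtrace (Rec (fun x y => al x * conjc (be y))) = 0.
  rewrite tp => tr0; rewrite dotC -[X in conjc X](_ : mtrace (fun x y => al x * conjc (be y)) = _).
    by rewrite tr0 rmorph0.
  by apply: eq_bigr => x _; rewrite mulrC.
rewrite -[LHS](_ : \sum_x Y (ord0, x) (i1, x) = _) //.
(* Each row of the off-diagonal block vanishes on the complement of [v], so it is a multiple of the
   conjugate of [v]. This is tested on [w], the basis vector at [x] minus its projection on [v]. *)
transitivity (\sum_x (dot v v)^-1 * (conjc (v x) * \sum_y Y (ord0, x) (i1, y) * v y)).
  apply: eq_bigr => x _; rewrite mulrA; set a := _ * conjc _.
  pose w y := (y == x)%:R - a * v y.
  have vw : dot v w = 0.
    rewrite dotBr [X in X - _](_ : _ = conjc (v x)); last first.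
      rewrite /dot (bigD1 x) //= eqxx mulr1 big1 ?addr0 // => y ne.
      by rewrite (negbTE ne) mulr0.
    rewrite [X in _ - X](_ : _ = a * dot v v) /a; last first.
      by rewrite /dot mulr_sumr; apply: eq_bigr => y _; ring.
    by rewrite mulrAC mulVf // mul1r subrr.
  have := ker1 w vw ord0 x; rewrite /w; under eq_bigr do rewrite mulrBr.
  rewrite sumrB (bigD1 x) //= eqxx mulr1 big1 ?addr0; last first.
    by move=> y ne; rewrite (negbTE ne) mulr0.
  move/eqP; rewrite subr_eq0 => /eqP ->; rewrite mulr_sumr.
  by apply: eq_bigr => y _; ring.
rewrite -mulr_sumr; set s := \sum_x _; suff -> : s = 0 by rewrite mulr0.
(* Hermitian symmetry moves the sum to the opposite block, whose columns are killed by everything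
   orthogonal to [u], in particular by [v]. *)
transitivity (\sum_y v y * conjc (\sum_x Y (i1, y) (ord0, x) * v x)).
  rewrite /s; under eq_bigr do rewrite mulr_sumr.
  rewrite exchange_big /=; apply: eq_bigr => y _.
  rewrite rmorph_sum mulr_sumr; apply: eq_bigr => x _ /=.
  by rewrite rmorphM /= -psdY.1; ring.
by rewrite big1 // => y _; rewrite ker0 // rmorph0 mulr0.
Qed.

End Necessity.

(** The operators [K i] undo every [E l] up to a scalar on both sides of [rho], so all terms
    [E l rho (E m)^*] come back as multiples of the same [rho]. No positivity of the weights [c]
    enters, only the total trace. *)
Lemma channel_recovery (R : realType) q N M (J L : finType) (S : vec R q N -> Prop)
    (Phi : op R q N -> op R q M) (c : J -> R[i]) (li mi : J -> L)
    (E : L -> idx q M -> idx q N -> R[i]) :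
  (0 < q)%N -> lin_space S ->
  (forall rho z z', Phi rho z z' =
     \sum_j c j * \sum_x \sum_y E (li j) z x * rho x y * conjc (E (mi j) z' y)) ->
  (forall rho, density rho -> mtrace (Phi rho) = 1) ->
  (forall l m u v, S u -> S v -> dot u v = 0 ->
    dot (app (E l) u) (app (E m) v) = 0) ->
  exists Rec : op R q M -> op R q N, quantum_channel Rec /\
    forall rho, density rho -> supported_on S rho -> Rec (Phi rho) = rho.
Proof.
move=> q0 Ssp PhiE trPhi HE.
pose x0 : idx q N := [ffun => Ordinal q0].
have [I [K [mu [HK KE]]]] := orthogonality_recovery x0 Ssp HE.
have chK := kraus_map_channel HK.
exists (kraus_map K); split=> // rho drho srho.
pose lam := \sum_i \sum_j c j * (mu i (li j) * conjc (mu i (mi j))).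
(* Columns of [rho] are its values on basis vectors, hence codewords. *)
have rhoS b : S (fun a => rho a b).
  rewrite [X in S X](_ : _ = fun a => \sum_y rho a y * (y == b)%:R) //.
  apply/funext => a; rewrite (bigD1 b) //= eqxx mulr1 big1 ?addr0 // => y ne.
  by rewrite (negbTE ne) mulr0.
have E1 : kraus_map K (Phi rho) = fun x y => lam * rho x y.
  apply/funext => x; apply/funext => y; rewrite /kraus_map /lam mulr_suml.
  apply: eq_bigr => i _; rewrite mulr_suml.
  transitivity (\sum_j \sum_z \sum_z' c j * (K i x z *
      (\sum_a \sum_b E (li j) z a * rho a b * conjc (E (mi j) z' b)) * conjc (K i y z'))).
    rewrite [RHS]exchange_big; apply: eq_bigr => z _ /=.
    rewrite [RHS]exchange_big; apply: eq_bigr => z' _ /=.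
    rewrite PhiE mulr_sumr mulr_suml; apply: eq_bigr => j _; ring.
  apply: eq_bigr => j _; rewrite -2!mulrA.
  under eq_bigr do rewrite -mulr_sumr.
  rewrite -mulr_sumr; congr (c j * _).
  transitivity (\sum_b app (K i) (app (E (li j)) (fun a => rho a b)) x *
                  conjc (\sum_z' K i y z' * E (mi j) z' b)).
    transitivity (\sum_b \sum_z \sum_z' (K i x z * \sum_a E (li j) z a * rho a b) *
                    conjc (K i y z' * E (mi j) z' b)).
      rewrite [RHS]exchange_big; apply: eq_bigr => z _ /=.
      rewrite [RHS]exchange_big; apply: eq_bigr => z' _ /=.
      rewrite exchange_big mulr_sumr mulr_suml; apply: eq_bigr => b _ /=.
      rewrite -mulr_suml rmorphM /=; ring.
    apply: eq_bigr => b _; rewrite /app mulr_suml; apply: eq_bigr => z _.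
    by rewrite rmorph_sum [RHS]mulr_sumr.
  under eq_bigr do rewrite KE // -mulrA.
  rewrite -mulr_sumr; congr (_ * _).
  (* The right factor acts on rows of [rho], which are conjugates of columns, so [KE] applies a
     second time. *)
  have herm a b : rho a b = conjc (rho b a) by apply: drho.1.1.
  rewrite (herm x y) -rmorphM /= -(KE i (mi j) (fun a => rho a x)) // /app rmorph_sum.
  under eq_bigr do rewrite rmorph_sum mulr_sumr.
  rewrite exchange_big; apply: eq_bigr => z _ /=.
  rewrite mulr_sumr rmorph_sum; apply: eq_bigr => b _ /=.
  by rewrite (herm x b) !rmorphM /=; ring.
suff lam1 : lam = 1.
  by rewrite E1 lam1; apply/funext => x; apply/funext => y; rewrite mul1r.
have [_ _ tp] := chK; have := tp (Phi rho).
by rewrite trPhi // E1 /mtrace -mulr_sumr -[X in _ * X]/(mtrace rho) drho.2 mulr1.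
Qed.

(** * Insertions and deletions on words *)

Section Words.
Variables (R : realType) (q : nat) (d : 'I_q).
Local Notation C := (R[i]).

(** Plain sequences carry no length in their type, so the casts between equal numbers of qudits
    disappear from all later computations. *)
Definition word m (x : idx q m) : seq 'I_q := [seq x i | i <- enum 'I_m].
Definition toidx m (s : seq 'I_q) : idx q m := [ffun i : 'I_m => nth d s i].

Lemma size_word m (x : idx q m) : size (word x) = m.
Proof. by rewrite size_map size_enum_ord. Qed.

Lemma nth_word m (x : idx q m) (i : 'I_m) : nth d (word x) i = x i.
Proof. by rewrite (nth_map i) ?size_enum_ord // nth_ord_enum. Qed.

Lemma wordK m (x : idx q m) : toidx m (word x) = x.
Proof. by apply/ffunP => i; rewrite ffunE nth_word. Qed.

Lemma toidxK m (s : seq 'I_q) : size s = m -> word (toidx m s) = s.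
Proof.
move=> sm; apply: (@eq_from_nth _ d); rewrite size_word // => i im.
by rewrite -[X in nth d _ X]/(val (Ordinal im)) nth_word ffunE.
Qed.

Lemma word_inj m : injective (@word m).
Proof. by move=> x y xy; rewrite -[x]wordK xy wordK. Qed.

Lemma nth_rem_at T (d0 : T) p (s : seq T) i : (p <= size s)%N ->
  nth d0 (rem_at p s) i = nth d0 s (bump p i).
Proof.
move=> ps; rewrite /rem_at nth_cat size_takel // /bump.
case: ltnP => ip; first by rewrite nth_take.
by rewrite nth_drop; congr nth; lia.
Qed.

Lemma nth_rem_at_lt T (d0 : T) p (s : seq T) i : (i < p)%N ->
  nth d0 (rem_at p s) i = nth d0 s i.
Proof.
move=> ip; case: (leqP p (size s)) => ps.
  by rewrite nth_rem_at // /bump leqNgt ip.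
by rewrite /rem_at take_oversize ?drop_oversize ?cats0 //; lia.
Qed.

Lemma nth_cut T (d0 : T) l (s : seq T) i : all (ltn i) l ->
  nth d0 (cut l s) i = nth d0 s i.
Proof.
elim: l => // p l IH /= /andP[ip al].
by rewrite -[cut _ _]/(rem_at p (cut l s)) nth_rem_at_lt // IH.
Qed.

Lemma size_rem_at T p (s : seq T) : (p < size s)%N -> size (rem_at p s) = (size s).-1.
Proof. by move=> ps; rewrite /rem_at size_cat size_takel ?size_drop; lia. Qed.

Lemma sorted_ltn_size p l n : path ltn p l -> all (gtn n) (p :: l) -> (p + size l < n)%N.
Proof.
elim: l p => [|p' l IH] p; first by rewrite /= addn0 andbT.
by move=> /andP[pp pl] /andP[_ al]; have := IH p' pl al; move: pp => /=; lia.
Qed.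

Lemma size_cut T l (s : seq T) : sorted ltn l -> all (gtn (size s)) l ->
  size (cut l s) = (size s - size l)%N.
Proof.
elim: l => [|p l IH] //= pl pal; first by rewrite subn0.
have /andP[ps al] := pal.
have sl := IH (path_sorted pl) al.
rewrite -[cut _ _]/(rem_at p (cut l s)) size_rem_at sl; first by lia.
by have := sorted_ltn_size pl pal; lia.
Qed.

Lemma word_idx_del m (k : 'I_m.+1) (x : idx q m.+1) :
  word (idx_del k x) = rem_at k (word x).
Proof.
apply: (@eq_from_nth _ d).
  by rewrite size_rem_at !size_word.
move=> i; rewrite size_word => im.
rewrite -[X in nth d _ X]/(val (Ordinal im)) nth_word ffunE nth_rem_at ?size_word; last exact: ltnW.
by rewrite -nth_word.
Qed.

Lemma idx_insK m (k : 'I_m.+1) a (x : idx q m) : idx_del k (idx_ins k a x) = x.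
Proof. by apply/ffunP => i; rewrite !ffunE liftK. Qed.

Lemma idx_ins_at m (k : 'I_m.+1) a (x : idx q m) : idx_ins k a x k = a.
Proof. by rewrite ffunE unlift_none. Qed.

Lemma idx_delK m (k : 'I_m.+1) (x : idx q m.+1) : idx_ins k (x k) (idx_del k x) = x.
Proof. by apply/ffunP => i; rewrite !ffunE; case: unliftP => [j|] -> //; rewrite ffunE. Qed.

Lemma sum_idx_ins (V : nmodType) m (k : 'I_m.+1) (F : idx q m.+1 -> V) :
  \sum_x F x = \sum_(a < q) \sum_x F (idx_ins k a x).
Proof.
rewrite pair_bigA /= (reindex (fun p => idx_ins k p.1 p.2)) //=.
exists (fun x : idx q m.+1 => (x k, idx_del k x)) => [[a x] _|x _] /=; last exact: idx_delK.
by rewrite idx_ins_at idx_insK.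
Qed.

Lemma mtrace_In m (k : 'I_m.+1) (s : qstate R q) (rho : op R q m) :
  mtrace (In k s rho) = mtrace s * mtrace rho.
Proof.
rewrite /mtrace (sum_idx_ins k) mulr_suml; apply: eq_bigr => a _.
by rewrite mulr_sumr; apply: eq_bigr => x _; rewrite /In idx_ins_at idx_insK.
Qed.

Lemma mtrace_Trp m (k : 'I_m.+1) (rho : op R q m.+1) : mtrace (Trp k rho) = mtrace rho.
Proof. by rewrite /mtrace (sum_idx_ins k) exchange_big. Qed.

Lemma mtrace_ins_seq (l : seq (nat * qstate R q)) m (rho : op R q m) :
  mtrace (@ins_seq R q l m rho) = (\prod_(ps <- l) mtrace ps.2) * mtrace rho.
Proof.
elim: l m rho => [|[p s] l IH] m rho; first by rewrite big_nil mul1r.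
by rewrite big_cons /= IH mtrace_In mulrCA mulrA.
Qed.

Lemma mtrace_era_seq l m (rho : op R q m) :
  (size l <= m)%N -> mtrace (@era_seq R q l m rho) = mtrace rho.
Proof.
elim: l m rho => // p l IH [|m] rho //= lm.
by rewrite IH // mtrace_Trp.
Qed.

Lemma opcastE m n (e : m = n) (A : op R q m) (x y : idx q n) :
  opcast A x y = A (toidx m (word x)) (toidx m (word y)).
Proof.
subst n; rewrite /opcast; case: eqP => // e.
by rewrite (eq_irrelevance e erefl) /= !wordK.
Qed.

Lemma mtrace_opcast m n (e : m = n) (A : op R q m) : mtrace (opcast A : op R q n) = mtrace A.
Proof. by subst n; apply: eq_bigr => x _; rewrite opcastE // wordK. Qed.

Lemma ins_tgtE (A : Type) m (l : seq A) : ins_tgt m l = (m + size l)%N.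
Proof. by elim: l m => [|a l IH] m /=; rewrite ?addn0 // IH addnS. Qed.

Lemma era_tgtE m l : era_tgt m l = (m - size l)%N.
Proof. by elim: l m => [|a l IH] m /=; rewrite ?subn0 // IH; lia. Qed.

(** Insertions happen in increasing order, so a later one never moves an earlier inserted letter:
    each position in [l] is already the final one. *)
Lemma ins_seqE (l : seq (nat * qstate R q)) m (rho : op R q m) z z' :
  sorted ltn (map fst l) -> all (gtn (m + size l)%N) (map fst l) ->
  @ins_seq R q l m rho z z' =
    (\prod_(ps <- l) ps.2 (nth d (word z) ps.1) (nth d (word z') ps.1)) *
    rho (toidx m (cut (map fst l) (word z))) (toidx m (cut (map fst l) (word z'))).
Proof.
elim: l m rho z z' => [|[p s] l IH] m rho z z' srt al.
  by rewrite big_nil mul1r !wordK.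
have [pl pal] : path ltn p (map fst l) /\ all (ltn p) (map fst l).
  by split=> //; apply: order_path_min ltn_trans srt.
have pm : (p < m.+1)%N.
  by have := sorted_ltn_size pl al; rewrite size_map /=; lia.
have sl := path_sorted pl.
have al' : all (gtn (m.+1 + size l)%N) (map fst l) by rewrite addSnnS; case/andP: al.
have sc (w : idx q (ins_tgt m.+1 l)) : size (cut (map fst l) (word w)) = m.+1.
  rewrite size_cut // ?size_word ins_tgtE //.
  by rewrite size_map addnK.
rewrite big_cons /= IH // /In_nat /In.
have delE (w : idx q (ins_tgt m.+1 l)) :
    idx_del (inord p) (toidx m.+1 (cut (map fst l) (word w))) =
    toidx m (cut (p :: map fst l) (word w)).
  by apply: word_inj; rewrite word_idx_del inordK // !toidxK // -/(cut _ _) size_rem_at sc.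
rewrite !delE !ffunE inordK // !nth_cut //; ring.
Qed.

(** Tracing out the largest position first leaves the smaller ones in place. Each partial trace
    forces the row and the column word to agree in the erased letter, which gives the condition on
    [sel]. *)
Lemma era_seqE l m (rho : op R q m) s t : sorted gtn l -> all (gtn m) l ->
  @era_seq R q l m rho s t = \sum_x \sum_y
    [&& cut (rev l) (word x) == word s, cut (rev l) (word y) == word t &
        sel d l (word x) == sel d l (word y)]%:R * rho x y.
Proof.
elim: l m rho s t => [|p l IH] m rho s t srt al.
  rewrite (bigD1 s) //= [X in _ + X]big1 ?addr0; last first.
    move=> x ne; rewrite big1 // => y _; rewrite (inj_eq (@word_inj _)).
    by rewrite (negbTE ne) mul0r.
  rewrite (bigD1 t) //= [X in _ + X]big1 ?addr0; last first.
    by move=> y ne; rewrite (inj_eq (@word_inj _) y) (negbTE ne) andbF mul0r.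
  by rewrite !eqxx mul1r.
case: m rho s t al => [|m] rho s t al; first by case/andP: al.
have pal : all (gtn p) l.
  by apply: order_path_min srt => a b c /= ba ca; apply: ltn_trans ca ba.
have pm : (p < m.+1)%N by case/andP: al.
have pI : (inord p : 'I_m.+1) = p :> nat by rewrite inordK.
rewrite /= IH ?(path_sorted srt) //; last first.
  by apply: sub_all pal => i /= ip; lia.
rewrite (sum_idx_ins (inord p)) [RHS]exchange_big; apply: eq_bigr => x _ /=.
(* The single traced letter is doubled with a Kronecker delta, so that [x] and [y] can be extended
   independently. *)
transitivity (\sum_y \sum_(a < q) \sum_(b < q) ((a == b)%:R * [&& cut (rev l) (word x) == word s,
   cut (rev l) (word y) == word t & sel d l (word x) == sel d l (word y)]%:R *
     rho (idx_ins (inord p) a x) (idx_ins (inord p) b y))).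
  apply: eq_bigr => y _; rewrite mulr_sumr; apply: eq_bigr => a _.
  rewrite (bigD1 a) //= eqxx mul1r big1 ?addr0 // => b ne.
  by rewrite eq_sym (negbTE ne) !mul0r.
rewrite exchange_big; apply: eq_bigr => a _ /=.
rewrite (sum_idx_ins (inord p)) [RHS]exchange_big; apply: eq_bigr => y _ /=.
apply: eq_bigr => b _; congr (_ * _).
have cutE c (w : idx q m) : cut (rev (p :: l)) (word (idx_ins (inord p) c w)) = cut (rev l) (word w).
  rewrite rev_cons /cut foldr_rcons; congr foldr.
  by rewrite -{1}pI -word_idx_del idx_insK.
have selE c (w : idx q m) : sel d (p :: l) (word (idx_ins (inord p) c w)) = c :: sel d l (word w).
  rewrite /sel /= -[X in nth _ _ X]pI nth_word idx_ins_at.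
  congr cons; apply/eq_in_map => i il.
  have ip := allP pal _ il.
  by rewrite -(@nth_rem_at_lt _ d p) // -{1}pI -word_idx_del idx_insK.
rewrite !cutE !selE eqseq_cons -natrM mulnb.
by case: (a == b); rewrite ?andbF.
Qed.

End Words.

(** * Integrals of bounded complex functions *)

Section ComplexIntegral.
Variables (R : realType) (dd : measure_display) (Omega : measurableType dd).
Variable mu : probability Omega R.
Local Notation C := (R[i]).
Local Notation Re := complex.Re.
Local Notation Im := complex.Im.

(** Boundedness rather than integrability, because the integrands are products of entries of states
    and integrability is not stable under products. *)
Definition bounded_measurable (f : Omega -> C) : Prop :=
  [/\ measurable_fun setT (fun w => Re (f w)),
      measurable_fun setT (fun w => Im (f w)) &
      exists B, forall w, `|Re (f w)| <= B /\ `|Im (f w)| <= B].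

Lemma ReM (a b : C) : Re (a * b) = Re a * Re b - Im a * Im b.
Proof. by case: a; case: b. Qed.

Lemma ImM (a b : C) : Im (a * b) = Re a * Im b + Im a * Re b.
Proof. by case: a; case: b. Qed.

Lemma ReD (a b : C) : Re (a + b) = Re a + Re b.
Proof. by case: a; case: b. Qed.

Lemma ImD (a b : C) : Im (a + b) = Im a + Im b.
Proof. by case: a; case: b. Qed.

Lemma bounded_measurable_cst a : bounded_measurable (fun=> a).
Proof.
split; try exact: measurable_cst.
by exists (`|Re a| + `|Im a|) => w; rewrite lerDl lerDr !normr_ge0.
Qed.

Lemma bounded_measurableD f g : bounded_measurable f -> bounded_measurable g ->
  bounded_measurable (fun w => f w + g w).
Proof.
move=> [f1 f2 [B HB]] [g1 g2 [D HD]]; split.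
- by under eq_fun do rewrite ReD; apply: measurable_funD.
- by under eq_fun do rewrite ImD; apply: measurable_funD.
- exists (B + D) => w; rewrite ReD ImD.
  have [? ?] := HB w; have [? ?] := HD w.
  by split; apply: le_trans (ler_normD _ _) _; apply: lerD.
Qed.

Lemma bounded_measurableM f g : bounded_measurable f -> bounded_measurable g ->
  bounded_measurable (fun w => f w * g w).
Proof.
move=> [f1 f2 [B HB]] [g1 g2 [D HD]]; split.
- by under eq_fun do rewrite ReM; apply: measurable_funB; apply: measurable_funM.
- by under eq_fun do rewrite ImM; apply: measurable_funD; apply: measurable_funM.
- exists (B * D + B * D) => w; rewrite ReM ImM.
  have [? ?] := HB w; have [? ?] := HD w.
  split; first apply: le_trans (ler_normB _ _) _;
    last apply: le_trans (ler_normD _ _) _;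
  by rewrite !normrM; apply: lerD; apply: ler_pM.
Qed.

Lemma bounded_measurable_sum (I : finType) (P : pred I) (f : I -> Omega -> C) :
  (forall i, P i -> bounded_measurable (f i)) ->
  bounded_measurable (fun w => \sum_(i | P i) f i w).
Proof.
move=> Hf; suff H (r : seq I) : bounded_measurable (fun w => \sum_(i <- r | P i) f i w).
  exact: H.
elim: r => [|i r IH].
  by under eq_fun do rewrite big_nil; apply: bounded_measurable_cst.
case Pi : (P i); under eq_fun do rewrite big_cons Pi; last by [].
by apply: bounded_measurableD => //; apply: Hf.
Qed.

Lemma bounded_measurable_prod (I : finType) (f : I -> Omega -> C) :
  (forall i, bounded_measurable (f i)) -> bounded_measurable (fun w => \prod_i f i w).
Proof.
move=> Hf; suff H (r : seq I) : bounded_measurable (fun w => \prod_(i <- r) f i w).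
  exact: H.
elim: r => [|i r IH].
  by under eq_fun do rewrite big_nil; apply: bounded_measurable_cst.
by under eq_fun do rewrite big_cons; apply: bounded_measurableM.
Qed.

Lemma bounded_integrable (f : Omega -> R) (B : R) : measurable_fun setT f ->
  (forall w, `|f w| <= B) -> mu.-integrable setT (EFin \o f).
Proof.
move=> mf Bf; apply: measurable_bounded_integrable => //.
  by apply: (@le_lt_trans _ _ 1%E); [exact: probability_le1|rewrite ltry].
exists B; split; first exact: num_real.
by move=> M BM w _; apply: le_trans (Bf w) (ltW BM).
Qed.

Lemma bounded_measurable_integrable f : bounded_measurable f ->
  mu.-integrable setT (EFin \o (fun w => Re (f w))) /\
  mu.-integrable setT (EFin \o (fun w => Im (f w))).
Proof.
move=> [f1 f2 [B HB]].
by split; apply: (@bounded_integrable _ B) => // w; case: (HB w).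
Qed.

Lemma cintD f g : bounded_measurable f -> bounded_measurable g ->
  cint mu (fun w => f w + g w) = cint mu f + cint mu g.
Proof.
move=> /bounded_measurable_integrable[f1 f2] /bounded_measurable_integrable[g1 g2].
rewrite /cint -[RHS]/(Complex (_ + _) (_ + _)); congr Complex.
- by under eq_Rintegral do rewrite ReD; apply: RintegralD.
- by under eq_Rintegral do rewrite ImD; apply: RintegralD.
Qed.

Lemma cint_cst a : cint mu (fun=> a) = a.
Proof.
have intE (b : R) : Rintegral mu setT (fun=> b) = b.
  rewrite Rintegral_cst //; have mu1 := probability_setT mu.
  by transitivity (b * fine (mu setT)); [|rewrite mu1 mulr1].
by rewrite /cint !intE; case: a.
Qed.

Lemma cintZr f a : bounded_measurable f -> cint mu (fun w => f w * a) = cint mu f * a.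
Proof.
move=> bf; have [f1 f2] := bounded_measurable_integrable bf.
have zr (g : Omega -> R) (b : R) : mu.-integrable setT (EFin \o g) ->
    mu.-integrable setT (EFin \o (fun w => g w * b)).
  move=> ig; rewrite [X in mu.-integrable _ X](_ : _ = fun w => (b%:E * (EFin \o g) w)%E).
    exact: integrableZl.
  by apply/funext => w /=; rewrite -EFinM mulrC.
apply/eqP; rewrite eq_complex ReM ImM /=; apply/andP; split; apply/eqP.
- under eq_Rintegral do rewrite ReM.
  by rewrite RintegralB ?RintegralZr //; apply: zr.
- under eq_Rintegral do rewrite ImM.
  by rewrite RintegralD ?RintegralZr //; apply: zr.
Qed.

Lemma cint_sum (I : finType) (P : pred I) (f : I -> Omega -> C) :
  (forall i, P i -> bounded_measurable (f i)) ->
  cint mu (fun w => \sum_(i | P i) f i w) = \sum_(i | P i) cint mu (f i).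
Proof.
move=> Hf.
suff H (r : seq I) : bounded_measurable (fun w => \sum_(i <- r | P i) f i w) /\
    cint mu (fun w => \sum_(i <- r | P i) f i w) = \sum_(i <- r | P i) cint mu (f i).
  by case: (H (index_enum I)).
elim: r => [|i r [IH1 IH2]].
  rewrite [fun w => _](_ : _ = fun=> 0); last by apply/funext => w; rewrite big_nil.
  by rewrite big_nil cint_cst; split=> //; apply: bounded_measurable_cst.
rewrite big_cons [fun w => _](_ : _ = if P i then fun w => f i w + \sum_(j <- r | P j) f j w
  else fun w => \sum_(j <- r | P j) f j w); last first.
  by apply/funext => w; rewrite big_cons; case: ifP.
case: ifP => // Pi.
by split; [apply: bounded_measurableD => //; apply: Hf|rewrite cintD ?IH2 //; apply: Hf].
Qed.

Lemma bounded_measurable_real (p : Omega -> R) (B : R) : measurable_fun setT p ->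
  (forall w, `|p w| <= B) -> bounded_measurable (fun w => (p w)%:C%C).
Proof.
move=> mp Bp; split=> //=.
exists B => w /=; split; first exact: Bp.
by rewrite normr0; apply: le_trans (Bp w).
Qed.

End ComplexIntegral.

(** * Bounds on the entries of a density matrix *)

Section DensityBound.
Variable R : realType.
Local Notation C := (R[i]).
Local Notation Re := complex.Re.
Local Notation Im := complex.Im.

(** Positivity on [e a + t e b] with [|t| = 1], together with diagonal entries at most 1, gives
    [Re (t * s a b) >= -1]. The choices [1], [-1], [i], [-i] bound both parts. *)
Lemma density_bound (T : finType) (s : T -> T -> C) a b : density s ->
  `|Re (s a b)| <= 1 /\ `|Im (s a b)| <= 1.
Proof.
move=> [ps trs].
pose e (a : T) (x : T) : C := (x == a)%:R.
have sE a' b' : dot (e a') (app s (e b')) = s a' b'.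
  rewrite /dot (bigD1 a') //= /e eqxx rmorph1 mul1r big1 ?addr0; last first.
    by move=> x ne; rewrite (negbTE ne) rmorph0 mul0r.
  rewrite /app (bigD1 b') //= eqxx mulr1 big1 ?addr0 // => x ne.
  by rewrite (negbTE ne) mulr0.
have diag0 c : 0 <= s c c by rewrite -sE; apply: psdE.
have diag1 c : Re (s c c) <= 1.
  have : s c c <= 1.
    by rewrite -trs /mtrace (bigD1 c) //= lerDl sumr_ge0.
  by rewrite lecE => /andP[].
have key (t : C) : conjc t * t = 1 -> -1 <= Re (t * s a b).
  move=> tt; have := psdE ps (fun x => 1 * e a x + t * e b x).
  rewrite app_lin !dot_linl !dot_linr !sE rmorph1 !mul1r mulrDr mulrA tt mul1r.
  rewrite (ps.1 a b) -rmorphM /= lecE => /andP[_]; rewrite !ReD /=.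
  have -> : Re (conjc (t * s a b)) = Re (t * s a b) by case: (t * s a b).
  by have := diag1 a; have := diag1 b; lra.
have ii : conjc ('i%C : C) * 'i%C = 1.
  by apply/eqP; rewrite eq_complex /=; apply/andP; split; apply/eqP; ring.
have k1 := key 1; have k2 := key (-1); have k3 := key 'i%C ii; have k4 := key (- 'i%C).
rewrite mul1r rmorph1 mulr1 in k1; have {}k1 := k1 erefl.
rewrite mulN1r rmorphN rmorph1 mulrNN mulr1 in k2; have {}k2 := k2 erefl.
rewrite rmorphN mulrNN in k4; have {}k4 := k4 ii.
move: k1 k2 k3 k4; rewrite mulNr; case: (s a b) => x y /= k1 k2 k3 k4.
by rewrite !ler_norml; split; lra.
Qed.

End DensityBound.

(** * Kraus form of the insdel channels *)

Definition positions n (P : {set 'I_n}) : seq nat := sort leq [seq val i | i <- enum P].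

Lemma positions_uniq n (P : {set 'I_n}) : uniq (positions P).
Proof. by rewrite sort_uniq map_inj_uniq ?enum_uniq //; apply: val_inj. Qed.

Lemma positions_sorted n (P : {set 'I_n}) : sorted ltn (positions P).
Proof.
by rewrite ltn_sorted_uniq_leq positions_uniq sort_sorted //; apply: leq_total.
Qed.

Lemma positions_lt n (P : {set 'I_n}) : all (gtn n) (positions P).
Proof. by apply/allP => p; rewrite mem_sort => /mapP[i _ ->] /=; apply: ltn_ord. Qed.

Lemma size_positions n (P : {set 'I_n}) : size (positions P) = #|P|.
Proof. by rewrite size_sort size_map cardE. Qed.

Lemma mem_positions n (P : {set 'I_n}) (i : 'I_n) : (val i \in positions P) = (i \in P).
Proof. by rewrite mem_sort mem_map ?mem_enum //; apply: val_inj. Qed.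

Lemma positions_set n (l : seq nat) : sorted ltn l -> all (gtn n) l ->
  positions [set i : 'I_n | val i \in l] = l.
Proof.
move=> sl al; apply: (irr_sorted_eq ltn_trans ltnn) => //; first exact: positions_sorted.
move=> p; apply/idP/idP => [|pl].
  by rewrite mem_sort => /mapP[k]; rewrite mem_enum inE => kl ->.
by rewrite -[p]/(val (Ordinal (allP al _ pl))) mem_positions inE.
Qed.

Lemma sort_geq_positions n (P : {set 'I_n}) :
  sort geq [seq val i | i <- enum P] = rev (positions P).
Proof.
apply: (sorted_eq (leT := geq)).
- by move=> a b c /= ba ca; apply: leq_trans ca ba.
- by move=> a b /= H; apply/anti_leq; rewrite andbC.
- by apply: sort_sorted => a b; apply: leq_total.
- by rewrite rev_sorted; apply: sort_sorted; apply: leq_total.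
- by rewrite perm_sort perm_sym perm_rev perm_sort.
Qed.

Section KrausForm.
Variables (R : realType) (q : nat) (d : 'I_q).
Local Notation C := (R[i]).

Lemma InsE N t (P : {set 'I_(N + t)}) (s : t.-tuple (qstate R q)) (rho : op R q N) z z' :
  #|P| = t ->
  Ins P s rho z z' =
    (\prod_(i < t) tnth s i (nth d (sel d (positions P) (word z)) i)
                            (nth d (sel d (positions P) (word z')) i)) *
    rho (toidx d N (cut (positions P) (word z))) (toidx d N (cut (positions P) (word z'))).
Proof.
move=> Pt; rewrite /Ins -/(positions P); set l := positions P.
have sz : size l = t by rewrite size_positions.
have sizz : size (zip l s) = t by rewrite size_zip sz size_tuple minnn.
have unz : map fst (zip l s) = l by rewrite -/unzip1 unzip1_zip // sz size_tuple.
have tgt : ins_tgt N (zip l s) = (N + t)%N by rewrite ins_tgtE sizz.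
rewrite (opcastE d tgt) (ins_seqE d) ?unz ?sizz; last 2 first.
- exact: positions_sorted.
- exact: positions_lt.
rewrite !toidxK ?size_word //; congr (_ * _).
pose s0 : qstate R q := fun _ _ => 0.
rewrite (big_nth (0%N, s0)) sizz big_mkord; apply: eq_bigr => i _.
by rewrite nth_zip ?sz ?size_tuple //= /sel !(nth_map 0%N) ?sz // -tnth_nth.
Qed.

Lemma mtrace_Ins N t (P : {set 'I_(N + t)}) (s : t.-tuple (qstate R q)) (rho : op R q N) :
  #|P| = t -> (forall i, density (tnth s i)) -> mtrace (Ins P s rho) = mtrace rho.
Proof.
move=> Pt ds; rewrite /Ins -/(positions P); set l := positions P.
have sz : size l = t by rewrite size_positions.
have sizz : size (zip l s) = t by rewrite size_zip sz size_tuple minnn.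
rewrite (mtrace_opcast d) ?ins_tgtE ?sizz // mtrace_ins_seq.
pose s0 : qstate R q := fun _ _ => 0.
rewrite (big_nth (0%N, s0)) sizz big_mkord big1 ?mul1r // => i _.
by rewrite nth_zip ?sz ?size_tuple //= -tnth_nth; apply: (ds i).2.
Qed.

Lemma EraE N t (P : {set 'I_N}) (rho : op R q N) s s' : #|P| = t ->
  Era (t := t) P rho s s' = \sum_x \sum_y
    [&& cut (positions P) (word x) == word s, cut (positions P) (word y) == word s' &
        sel d (positions P) (word x) == sel d (positions P) (word y)]%:R * rho x y.
Proof.
move=> Pt; rewrite /Era sort_geq_positions.
have tgt : era_tgt N (rev (positions P)) = (N - t)%N.
  by rewrite era_tgtE size_rev size_positions Pt.
rewrite (opcastE d tgt) (era_seqE d); last 2 first.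
- by rewrite rev_sorted; apply: positions_sorted.
- by rewrite all_rev; apply: positions_lt.
apply: eq_bigr => x _; apply: eq_bigr => y _; rewrite !toidxK ?size_word // revK.
by rewrite /sel !map_rev (inj_eq (can_inj revK)).
Qed.

Lemma mtrace_Era N t (P : {set 'I_N}) (rho : op R q N) : #|P| = t ->
  mtrace (Era (t := t) P rho) = mtrace rho.
Proof.
move=> Pt; rewrite /Era sort_geq_positions (mtrace_opcast d); last first.
  by rewrite era_tgtE size_rev size_positions Pt.
by rewrite mtrace_era_seq // size_rev size_positions -[X in (_ <= X)%N]card_ord max_card.
Qed.

Lemma mtrace_del_channel N t (Phi : op R q N -> op R q (N - t)) rho :
  del_channel Phi -> mtrace (Phi rho) = mtrace rho.
Proof.
move=> [p [_ _ p1 PhiE]]; rewrite /mtrace; under eq_bigr do rewrite PhiE.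
rewrite exchange_big /=.
transitivity (\sum_(P : {set 'I_N} | #|P| == t) (p P)%:C%C * mtrace rho).
  by apply: eq_bigr => P /eqP Pt; rewrite -mulr_sumr -(mtrace_Era rho Pt).
by rewrite -mulr_suml -rmorph_sum /= p1 mul1r.
Qed.

(** For fixed [P] the integrand depends on the words only through the inserted letters, apart from a
    constant factor from [rho]. Its integral is a coefficient [g P b b'], and the probability space
    disappears from the rest of the argument. *)
Lemma ins_channel_coef N t (Phi : op R q N -> op R q (N + t)) : ins_channel Phi ->
  (forall rho, mtrace (Phi rho) = mtrace rho) /\
  exists g : {set 'I_(N + t)} -> seq 'I_q -> seq 'I_q -> C,
  forall rho z z', Phi rho z z' = \sum_(P : {set 'I_(N + t)} | #|P| == t)
    g P (sel d (positions P) (word z)) (sel d (positions P) (word z')) *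
    rho (toidx d N (cut (positions P) (word z))) (toidx d N (cut (positions P) (word z'))).
Proof.
move=> [dd [Om [mu [s [p [ds [p0 [pn [p1 [ms [mp PhiE]]]]]]]]]]].
have ple w P : `|p w P| <= 1.
  rewrite ger0_norm //; case: (eqVneq #|P| t) => [Pt|/pn -> //].
  by rewrite -(p1 w) (bigD1 P) ?Pt //= lerDl sumr_ge0.
have bp P : bounded_measurable (fun w => (p w P)%:C%C).
  by apply: (bounded_measurable_real (B := 1)).
have bs i a b : bounded_measurable (fun w => tnth (s w) i a b).
  have [m1 m2] := ms i a b; split=> //.
  by exists 1 => w; apply: density_bound.
have bc P (b b' : seq 'I_q) : bounded_measurable (fun w => (p w P)%:C%C *
    \prod_(i < t) tnth (s w) i (nth d b i) (nth d b' i)).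
  by apply: bounded_measurableM => //; apply: bounded_measurable_prod.
have bIns (P : {set 'I_(N + t)}) rho z z' : #|P| == t ->
    bounded_measurable (fun w => (p w P)%:C%C * Ins P (s w) rho z z').
  move=> /eqP Pt; under eq_fun do rewrite InsE // mulrA.
  by apply: bounded_measurableM => //; apply: bounded_measurable_cst.
split=> [rho|].
  rewrite /mtrace; under eq_bigr do rewrite PhiE.
  rewrite -cint_sum; last first.
    by move=> z _; apply: bounded_measurable_sum => P; apply: bIns.
  rewrite -[RHS](cint_cst mu); congr cint; apply/funext => w.
  rewrite exchange_big /=.
  transitivity (\sum_(P : {set 'I_(N + t)} | #|P| == t) (p w P)%:C%C * mtrace rho).
    by apply: eq_bigr => P /eqP Pt; rewrite -mulr_sumr -(mtrace_Ins rho Pt (ds w)).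
  by rewrite -mulr_suml -rmorph_sum /= p1 mul1r.
exists (fun P b b' => cint mu (fun w => (p w P)%:C%C *
    \prod_(i < t) tnth (s w) i (nth d b i) (nth d b' i))) => rho z z'.
rewrite PhiE cint_sum; last by move=> P; apply: bIns.
apply: eq_bigr => P /eqP Pt; rewrite -cintZr //; congr cint; apply/funext => w.
by rewrite InsE // mulrA.
Qed.

(* [(Q, P, a, b)]: the letters [a] are deleted at [P], the letters [b] inserted at [Q]. *)
Definition kraus_label N t1 t2 : finType :=
  ({set 'I_(N - t2 + t1)} * {set 'I_N} * t2.-tuple 'I_q * t1.-tuple 'I_q)%type.

(** The label type contains sets of every cardinality; the tests on [#|Q|] and [#|P|] turn wrong
    ones into zero operators. *)
Definition kraus_rel N t1 t2 (l : kraus_label N t1 t2)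
    (z : idx q (N - t2 + t1)) (x : idx q N) : bool :=
  let: (Q, P, a, b) := l in
  [&& #|Q| == t1, #|P| == t2, sel d (positions P) (word x) == a,
      sel d (positions Q) (word z) == b &
      cut (positions P) (word x) == cut (positions Q) (word z)].

Lemma sum_tuple_eq t (s : seq 'I_q) (F : seq 'I_q -> C) : size s = t ->
  \sum_(b : t.-tuple 'I_q) (s == b)%:R * F b = F s.
Proof.
move=> st; pose b0 : t.-tuple 'I_q := tcast st (in_tuple s).
have b0E : val b0 = s by rewrite /b0 /= val_tcast.
rewrite (bigD1 b0) //= b0E eqxx mul1r big1 ?addr0 // => b ne.
case: eqP => [sb|_]; last by rewrite mul0r.
by case/eqP: ne; apply: val_inj; rewrite b0E sb.
Qed.

(** The partial trace forces the same deleted letters [a] on both sides, whereas an inserted state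
    may link distinct letters [b] and [b']. Hence the two labels of a term share [Q], [P] and [a]
    but not the inserted word. *)
Lemma insdel_kraus_form N t1 t2 (Phi1 : op R q (N - t2) -> op R q (N - t2 + t1))
    (Phi2 : op R q N -> op R q (N - t2))
    (g : {set 'I_(N - t2 + t1)} -> seq 'I_q -> seq 'I_q -> C) (p : {set 'I_N} -> C) :
  (t2 <= N)%N ->
  (forall rho z z', Phi1 rho z z' = \sum_(Q : {set 'I_(N - t2 + t1)} | #|Q| == t1)
    g Q (sel d (positions Q) (word z)) (sel d (positions Q) (word z')) *
    rho (toidx d (N - t2) (cut (positions Q) (word z)))
        (toidx d (N - t2) (cut (positions Q) (word z')))) ->
  (forall rho x y, Phi2 rho x y =
     \sum_(P : {set 'I_N} | #|P| == t2) p P * Era (t := t2) P rho x y) ->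
  forall rho z z', Phi1 (Phi2 rho) z z' =
    \sum_(j : {set 'I_(N - t2 + t1)} * {set 'I_N} * t2.-tuple 'I_q *
              t1.-tuple 'I_q * t1.-tuple 'I_q)
      let: (Q, P, a, b, b') := j in
      (g Q b b' * p P) * \sum_x \sum_y
        (kraus_rel (t1 := t1) (Q, P, a, b) z x)%:R * rho x y *
        conjc (kraus_rel (t1 := t1) (Q, P, a, b') z' y)%:R.
Proof.
move=> t2N Phi1E Phi2E rho z z'.
rewrite Phi1E [RHS]sum_pair [RHS]sum_pair [RHS]sum_pair [RHS]sum_pair.
rewrite big_mkcond; apply: eq_bigr => Q _.
case: ifP => Qt1; last first.
  rewrite big1 // => P _; rewrite big1 // => a _; rewrite big1 // => b _; rewrite big1 // => b' _.
  rewrite big1 ?mulr0 // => x _; rewrite big1 // => y _.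
  by rewrite /kraus_rel Qt1 !mul0r.
rewrite Phi2E mulr_sumr big_mkcond; apply: eq_bigr => P _.
case: ifP => Pt2; last first.
  rewrite big1 // => a _; rewrite big1 // => b _; rewrite big1 // => b' _.
  rewrite big1 ?mulr0 // => x _; rewrite big1 // => y _.
  by rewrite /kraus_rel Pt2 andbF !mul0r.
rewrite EraE; last exact/eqP.
set sz := sel d _ (word z); set sz' := sel d _ (word z').
have szt : size sz = t1 by rewrite size_map size_positions; apply/eqP.
have szt' : size sz' = t1 by rewrite size_map size_positions; apply/eqP.
have cutQ (w : idx q (N - t2 + t1)) : word (toidx d (N - t2) (cut (positions Q) (word w))) =
    cut (positions Q) (word w).
  apply: toidxK; rewrite size_cut ?positions_sorted ?size_word ?positions_lt //.
  by rewrite size_positions (eqP Qt1) addnK.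
rewrite !cutQ.
pose D (w : idx q (N - t2 + t1)) (x : idx q N) : C :=
  (cut (positions P) (word x) == cut (positions Q) (word w))%:R.
pose A (x : idx q N) := sel d (positions P) (word x).
have At (x : idx q N) : size (A x) = t2 by rewrite size_map size_positions; apply/eqP.
have krE a b w x : (kraus_rel (t1 := t1) (t2 := t2) (Q, P, a, b) w x)%:R =
    (sel d (positions Q) (word w) == b)%:R * ((A x == a)%:R * D w x) :> C.
  by rewrite /kraus_rel Qt1 Pt2 /= /D -!natrM !mulnb andbCA.
transitivity (\sum_(a : t2.-tuple 'I_q) \sum_(b : t1.-tuple 'I_q) \sum_(b' : t1.-tuple 'I_q)
    ((sz == b)%:R * ((sz' == b')%:R * (g Q b b' * p P))) *
    \sum_x \sum_y ((A x == a)%:R * D z x) * rho x y * ((A y == a)%:R * D z' y)); last first.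
  apply: eq_bigr => a _; apply: eq_bigr => b _; apply: eq_bigr => b' _.
  rewrite !mulr_sumr; apply: eq_bigr => x _; rewrite !mulr_sumr; apply: eq_bigr => y _.
  by rewrite conjc_nat !krE -/sz -/sz'; ring.
(* The sums over [b'] and then [b] collapse to the letters read from [z'] and [z]. *)
under [RHS]eq_bigr => a _.
  under eq_bigr => b _.
    rewrite -mulr_suml -mulr_sumr (sum_tuple_eq (fun b' => g Q b b' * p P) szt').
    over.
  rewrite -mulr_suml (sum_tuple_eq (fun b => g Q b sz' * p P) szt).
  over.
rewrite -mulr_sumr mulrA; congr (_ * _).
rewrite [RHS]exchange_big; apply: eq_bigr => x _ /=.
rewrite [RHS]exchange_big; apply: eq_bigr => y _ /=.
transitivity (\sum_(a : t2.-tuple 'I_q) (A x == a)%:R * ((A y == a)%:R * (D z x * D z' y * rho x y))).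
  rewrite (sum_tuple_eq (fun a => (A y == a)%:R * (D z x * D z' y * rho x y)) (At x)).
  by rewrite /D mulrA -!natrM !mulnb (eq_sym (A y)) [in LHS]andbA [in LHS]andbC.
by apply: eq_bigr => a _; ring.
Qed.

End KrausForm.

(** * Orthogonality depends only on the total number of edits *)

Section Orthogonality.
Variables (R : realType) (q : nat) (d : 'I_q) (N : nat).
Local Notation C := (R[i]).
(* The carrier is spelled out because [lia] does not identify the sizes of scripts
   over ['I_q] with those over the carrier of its [eqType]. *)
Local Notation script := (seq (edit (Equality.sort (fintype_ordinal__canonical__eqtype_Equality q)))).

Definition kraus_op t1 t2 (l : kraus_label q N t1 t2)
    (z : idx q (N - t2 + t1)) (x : idx q N) : C := (kraus_rel d l z x)%:R.

Definition script_op (e : script) (x y : idx q N) : C :=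
  (runs e (word x) (word y))%:R.

(** An insertion is a deletion read backwards: [x] and [z] are related when deleting at [P] from the
    one and at [Q] from the other leaves the same word. *)
Lemma kraus_rel_relay t1 t2 (Q : {set 'I_(N - t2 + t1)}) (P : {set 'I_N})
    (a : t2.-tuple 'I_q) (b : t1.-tuple 'I_q) :
  (t2 <= N)%N -> #|Q| = t1 -> #|P| = t2 ->
  exists e f : script,
    [/\ dropped e = a, added e = [::], dropped f = b, added f = [::] &
        forall x z, kraus_rel d (Q, P, a, b) z x <->
                    relay e (map (@flip _) f) (word x) (word z)].
Proof.
move=> t2N Qt Pt.
have [||e [e1 e2 e3 e4 e5]] := @exists_drops _ N (positions P) a (positions_sorted P).
- exact: positions_lt.
- by rewrite size_tuple size_positions.
have [||f [f1 f2 f3 f4 f5]] := @exists_drops _ (N - t2 + t1)%N (positions Q) b (positions_sorted Q).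
- exact: positions_lt.
- by rewrite size_tuple size_positions.
rewrite size_tuple in e5; rewrite size_tuple in f5.
have ke : keeps e = (N - t2)%N by lia.
have kf : keeps f = (N - t2)%N by lia.
have re (x : idx q N) s : size s = (N - t2)%N ->
    runs e (word x) s = (sel d (positions P) (word x) == a) && (cut (positions P) (word x) == s).
  move=> ss.
  have h1 : size (word x) = (keeps e + size (dropped e))%N by rewrite size_word e2 size_tuple.
  have h2 : size s = (keeps e + size (added e))%N by rewrite e4 addn0 ke.
  by rewrite (runsE d h1 h2) e1 e2 e3 e4.
have rf (z : idx q (N - t2 + t1)) s : size s = (N - t2)%N ->
    runs f (word z) s = (sel d (positions Q) (word z) == b) && (cut (positions Q) (word z) == s).
  move=> ss.
  have h1 : size (word z) = (keeps f + size (dropped f))%N by rewrite size_word f2 size_tuple.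
  have h2 : size s = (keeps f + size (added f))%N by rewrite f4 addn0 kf.
  by rewrite (runsE d h1 h2) f1 f2 f3 f4.
exists e, f; split=> // x z; rewrite /kraus_rel Qt Pt !eqxx /=; split.
  case/and3P=> xa zb cc; exists (cut (positions P) (word x)).
    rewrite re ?xa ?eqxx // size_cut ?positions_sorted ?size_word ?positions_lt //.
    by rewrite size_positions Pt.
  rewrite runs_flip rf ?zb 1?eq_sym //.
  rewrite size_cut ?positions_sorted ?size_word ?positions_lt //.
  by rewrite size_positions Pt.
case=> s es; rewrite runs_flip.
have ss : size s = (N - t2)%N by have [_ ->] := runs_size es; rewrite e4 addn0.
by move: es; rewrite re // rf // => /andP[-> /eqP->] /andP[-> /eqP->] /=.
Qed.

Lemma script_kraus t1 t2 (e : script) : (t2 <= N)%N ->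
  size (dropped e) = t2 -> size (added e) = t1 -> keeps e = (N - t2)%N ->
  exists l : kraus_label q N t1 t2, forall x z, kraus_rel d l z x = runs e (word x) (word z).
Proof.
move=> t2N dt at1 ke.
have pD : all (gtn N) (drop_pos e).
  have -> : N = (keeps e + size (dropped e))%N by lia.
  exact: drop_pos_lt.
have pA : all (gtn (N - t2 + t1)%N) (add_pos e).
  have -> : (N - t2 + t1)%N = (keeps (map (@flip _) e) + size (added e))%N.
    by rewrite keeps_flip; lia.
  exact: drop_pos_lt.
have PD := positions_set (drop_pos_sorted e) pD.
have PA := positions_set (drop_pos_sorted (map (@flip _) e)) pA.
exists ([set i | val i \in add_pos e], [set i | val i \in drop_pos e],
        tcast dt (in_tuple (dropped e)), tcast at1 (in_tuple (added e))) => x z.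
rewrite /kraus_rel -!size_positions PD PA !val_tcast /= !size_drop_pos dt at1 !eqxx /=.
have h1 : size (word x) = (keeps e + size (dropped e))%N by rewrite size_word; lia.
have h2 : size (word z) = (keeps e + size (added e))%N by rewrite size_word; lia.
by rewrite (runsE d h1 h2).
Qed.

Lemma kraus_rel_inj t1 t2 (l : kraus_label q N t1 t2) x z z' : (t2 <= N)%N ->
  kraus_rel d l z x -> kraus_rel d l z' x -> z = z'.
Proof.
case: l => -[[Q P] a] b t2N H H'; have /and3P[/eqP Qt /eqP Pt _] := H.
have [e [f [_ _ _ _ E]]] := kraus_rel_relay a b t2N Qt Pt.
have [s es sf] := (E x z).1 H; have [s' es' sf'] := (E x z').1 H'.
rewrite -(runs_inj es es') in sf'.
exact: word_inj (runs_inj sf sf').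
Qed.

(** An entry of [E^* F] counts the common outputs [z] of two basis words. By [kraus_rel_inj] there
    is at most one, so the count is a truth value. *)
Lemma kraus_dot t1 t2 (l m : kraus_label q N t1 t2) (u v : vec R q N) : (t2 <= N)%N ->
  dot (app (kraus_op l) u) (app (kraus_op m) v) =
  dot u (app (fun x y => [exists z, kraus_rel d l z x && kraus_rel d m z y]%:R) v).
Proof.
move=> t2N.
transitivity (\sum_x \sum_y conjc (u x) * (\sum_z kraus_op l z x * kraus_op m z y) * v y).
  rewrite /dot /app.
  transitivity (\sum_z \sum_x \sum_y conjc (u x) * (kraus_op l z x * kraus_op m z y) * v y).
    apply: eq_bigr => z _; rewrite rmorph_sum mulr_suml; apply: eq_bigr => x _ /=.
    rewrite mulr_sumr; apply: eq_bigr => y _.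
    by rewrite rmorphM /= {1}/kraus_op conjc_nat -/(kraus_op l z x); ring.
  rewrite exchange_big; apply: eq_bigr => x _ /=.
  rewrite exchange_big; apply: eq_bigr => y _ /=.
  by rewrite mulr_sumr mulr_suml.
apply: eq_bigr => x _; rewrite /app mulr_sumr; apply: eq_bigr => y _.
rewrite -mulrA; congr (_ * (_ * _)).
case: existsP => [[z /andP[lz mz]]|H]; last first.
  rewrite big1 // => z _; rewrite /kraus_op -natrM mulnb.
  by case zz: (_ && _) => //; case: H; exists z.
rewrite (bigD1 z) //= /kraus_op lz mz mul1r big1 ?addr0 // => z' ne.
case lz': (kraus_rel d l z' x); last by rewrite mul0r.
by rewrite (kraus_rel_inj t2N lz' lz) eqxx in ne.
Qed.

(** The product is the composite of four pure scripts: [e], flipped [f], [f'], flipped [e']. Only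
    [e] and [f'] drop letters, [t2] and [t1] of them. *)
Lemma kraus_gram_script t1 t2 (l m : kraus_label q N t1 t2) : (t2 <= N)%N ->
  (exists2 g : script, (size (dropped g) <= t1 + t2)%N &
     forall x y, [exists z, kraus_rel d l z x && kraus_rel d m z y] = runs g (word x) (word y)) \/
  (forall x y, [exists z, kraus_rel d l z x && kraus_rel d m z y] = false).
Proof.
move=> t2N; case: l => -[[Q P] a] b; case: m => -[[Q' P'] a'] b'.
have [QP|QP] := boolP [&& #|Q| == t1, #|P| == t2, #|Q'| == t1 & #|P'| == t2]; last first.
  right=> x y; apply/existsP => -[z /andP[]] /and3P[h1 h2 _] /and3P[h3 h4 _].
  by rewrite h1 h2 h3 h4 in QP.
case/and4P: QP => /eqP Qt /eqP Pt /eqP Qt' /eqP Pt'.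
have [e [f [e1 e2 f1 f2 E]]] := kraus_rel_relay a b t2N Qt Pt.
have [e' [f' [e1' e2' f1' f2' E']]] := kraus_rel_relay a' b' t2N Qt' Pt'.
have Ex x y : [exists z, kraus_rel d (Q, P, a, b) z x && kraus_rel d (Q', P', a', b') z y] <->
    exists z, relay e (map (@flip _) f) (word x) z /\ relay e' (map (@flip _) f') (word y) z.
  split=> [/existsP[z /andP[/E H /E' H']]|[z [H H']]]; first by exists (word z).
  have sz : size z = (N - t2 + t1)%N.
    have [s es sf] := H; have [_ ss] := runs_size es; have [s1 s2] := runs_size sf.
    have [s3 _] := runs_size es; rewrite size_word in s3.
    move: s1 s2; rewrite f2 -map_comp (eq_map (@flipK _)) map_id f1 keeps_flip.
    by rewrite e1 in s3; rewrite !size_tuple /= in s3 *; rewrite ss e2 /=; lia.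
  apply/existsP; exists (toidx d _ z); rewrite -(toidxK d sz) in H H'.
  by apply/andP; split; [apply/E|apply/E'].
have F1 := runs_relay e (map (@flip _) f); rewrite e1 f2 size_tuple addn0 in F1.
case: F1 => [[g1 sg1 G1]|G1]; last first.
  by right=> x y; apply/negbTE/negP => /Ex [z [/G1]].
have F2 := runs_relay g1 f'; rewrite f1' size_tuple in F2.
case: F2 => [[g2 sg2 G2]|G2]; last first.
  right=> x y; apply/negbTE/negP => /Ex [z [/G1 H [s es sf]]].
  by apply: (G2 (word x) s); exists z => //; rewrite -runs_flip.
have F3 := runs_relay g2 (map (@flip _) e'); rewrite e2' addn0 in F3.
case: F3 => [[g3 sg3 G3]|G3]; last first.
  right=> x y; apply/negbTE/negP => /Ex [z [/G1 H [s es sf]]].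
  apply: (G3 (word x) (word y)); exists s; last by rewrite runs_flip.
  by apply/G2; exists z => //; rewrite -runs_flip.
left; exists g3.
  apply: leq_trans sg3 _; apply: leq_trans sg2 _.
  by rewrite addnC leq_add2l.
move=> x y; apply/idP/idP => [/Ex [z [/G1 H [s es sf]]]|/G3 [s /G2 [z /G1 H fs] es]].
  apply/G3; exists s; last by rewrite runs_flip.
  by apply/G2; exists z => //; rewrite -runs_flip.
apply/Ex; exists z; split=> //; exists s; first by rewrite -runs_flip.
by rewrite runs_flip.
Qed.

(** A script with at least [t2] drops is itself a product [E^* F] of Kraus operators; one with fewer
    is a sum of scripts with one more drop, whence the induction on the deficit. *)
Lemma script_orthogonality t1 t2 (S : vec R q N -> Prop) : (t2 < N)%N ->
  (forall (l m : kraus_label q N t1 t2) u v, S u -> S v -> dot u v = 0 ->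
     dot (app (kraus_op l) u) (app (kraus_op m) v) = 0) ->
  forall g : script, (size (dropped g) <= t1 + t2)%N ->
  forall u v, S u -> S v -> dot u v = 0 -> dot u (app (script_op g) v) = 0.
Proof.
move=> t2N' H g sg u v Su Sv uv; have t2N := ltnW t2N'.
have [n] := ubnP (t2 - size (dropped g)).
elim: n g sg => // n IH g sg ng.
(* A script running on no pair of words of length [N] gives the zero operator; otherwise it has as
   many drops as additions. *)
have [/existsP[x0 /existsP[y0 r0]]|nr] :=
    boolP [exists x : idx q N, [exists y : idx q N, runs g (word x) (word y)]]; last first.
  rewrite /dot big1 // => x _; rewrite /app big1 ?mulr0 // => y _.
  rewrite /script_op; case r: (runs _ _ _); last by rewrite mul0r.
  by case/negP: nr; apply/existsP; exists x; apply/existsP; exists y.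
have [sx sy] := runs_size r0; rewrite !size_word in sx sy.
case: (leqP t2 (size (dropped g))) => jt.
  have jt' : (t2 <= size (added g))%N by lia.
  have [e [f [e1 e2 f1 f2 E]]] := relay_factor jt jt'.
  (* Each factor already adds [size (dropped g) - t2] letters; [r] is what is missing to reach [t1].
     The padding letter [d] is arbitrary. *)
  pose r := (t1 + t2 - size (dropped g))%N; pose pad : script := nseq r (Add d).
  have E1 x y : runs g x y <-> relay (pad ++ e) (map (@flip _) (pad ++ f)) x y.
    by rewrite relay_nseq_Add.
  have [pe1 pe2] := nseq_Add_sizes d r e; have [pf1 pf2] := nseq_Add_sizes d r f.
  rewrite -/pad in pe1 pe2 pf1 pf2.
  have ke : keeps (pad ++ e) = (N - t2)%N /\ keeps (pad ++ f) = (N - t2)%N.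
    have [s es sf] := (E1 _ _).1 r0; rewrite runs_flip in sf.
    have [a1 _] := runs_size es; have [a2 _] := runs_size sf.
    by rewrite !size_word in a1 a2; lia.
  have [||l Hl] := @script_kraus t1 t2 (pad ++ e) t2N _ _ ke.1; first by lia.
    by rewrite pe2 e2 /r; lia.
  have [||m Hm] := @script_kraus t1 t2 (pad ++ f) t2N _ _ ke.2; first by lia.
    by rewrite pf2 f2 /r; lia.
  have := H l m u v Su Sv uv; rewrite kraus_dot // => H0; rewrite -[RHS]H0; congr dot.
  apply/funext => x; apply: eq_bigr => y _; congr (_%:R * _); congr nat_of_bool.
  apply/idP/existsP => [/E1 [s es sf]|[z]].
    have [_ ss] := runs_size es.
    have sz : size s = (N - t2 + t1)%N by rewrite ss ke.1 pe2 e2 /r; lia.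
    exists (toidx d _ s); rewrite Hl Hm toidxK // es.
    by rewrite -runs_flip.
  rewrite Hl Hm => /andP[h1 h2]; apply/E1; exists (word z) => //.
  by rewrite runs_flip.
(* A kept letter exists because fewer than [t2 < N] letters are dropped. *)
have [|m1 [m2 gE]] := @split_keep _ g; first by lia.
have -> : app (script_op g) v =
    fun x => \sum_c 1 * app (script_op (m1 ++ Drop c :: Add c :: m2)) v x.
  apply/funext => x; rewrite /app; under [RHS]eq_bigr do rewrite mul1r.
  rewrite exchange_big; apply: eq_bigr => y _ /=.
  by rewrite -mulr_suml -natr_sum -runs_split_keep gE.
rewrite dot_sumr big1 // => c _; have [_ dc _] := split_keep_sizes m1 m2 c.
by rewrite IH ?mulr0 // dc -gE; lia.
Qed.

Lemma kraus_orthogonality t1 t2 s1 s2 (S : vec R q N -> Prop) :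
  (t2 < N)%N -> (s2 < N)%N -> (t1 + t2 = s1 + s2)%N ->
  (forall (l m : kraus_label q N t1 t2) u v, S u -> S v -> dot u v = 0 ->
     dot (app (kraus_op l) u) (app (kraus_op m) v) = 0) ->
  forall (l m : kraus_label q N s1 s2) u v, S u -> S v -> dot u v = 0 ->
    dot (app (kraus_op l) u) (app (kraus_op m) v) = 0.
Proof.
move=> t2N s2N ts H l m u v Su Sv uv; rewrite kraus_dot ?(ltnW s2N) //.
have [[g sg G]|G] := kraus_gram_script l m (ltnW s2N).
  rewrite -ts in sg; have := script_orthogonality t2N H sg Su Sv uv.
  move=> H0; rewrite -[RHS]H0; congr dot.
  by apply/funext => x; apply: eq_bigr => y _; rewrite G.
rewrite /dot big1 // => x _; rewrite /app big1 ?mulr0 // => y _.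
by rewrite G mul0r.
Qed.

End Orthogonality.

(** * One channel containing all Kraus operators *)

Section UniformChannel.
Variables (R : realType) (q : nat) (d : 'I_q).
Local Notation C := (R[i]).

Definition uniform_weight n t (P : {set 'I_n}) : R :=
  if #|P| == t then ('C(n, t))%:R^-1 else 0.

Lemma sum_uniform_weight n t : (t <= n)%N ->
  \sum_(P : {set 'I_n} | #|P| == t) uniform_weight t P = 1.
Proof.
move=> tn; rewrite (eq_bigr (fun=> ('C(n, t))%:R^-1)); last first.
  by move=> P Pt; rewrite /uniform_weight Pt.
rewrite sumr_const -[X in _ *+ X](_ : 'C(n, t) = _); last first.
  by rewrite -[in LHS](card_ord n) -card_draws cardsE.
by rewrite -[LHS]mulr_natr mulVf // pnatr_eq0 -lt0n bin_gt0.
Qed.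

Definition mixed_state : qstate R q := fun a b => (a == b)%:R / q%:R.

Lemma density_mixed_state : density mixed_state.
Proof.
have q0 : (q%:R : C) != 0 by rewrite pnatr_eq0 -lt0n; apply: leq_ltn_trans (ltn_ord d).
split; last first.
  rewrite /mtrace /mixed_state; under eq_bigr do rewrite eqxx.
  by rewrite sumr_const card_ord -[LHS]mulr_natr divfK.
split=> [x y|v].
  by rewrite /mixed_state rmorphM /= conjc_nat conjc_inv conjc_nat eq_sym.
rewrite -[X in 0 <= X](_ : q%:R^-1 * dot v v = _).
  by rewrite mulr_ge0 ?invr_ge0 ?ler0n // dot_ge0.
rewrite /dot mulr_sumr; apply: eq_bigr => x _.
rewrite (bigD1 x) //= /mixed_state eqxx mul1r big1 ?addr0 => [|y ne]; first by ring.
by rewrite eq_sym (negbTE ne) !mul0r mulr0 mul0r.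
Qed.

(** Maximally mixed states have no off-diagonal entries and constant diagonal [1/q], so only terms
    with [b = b'] survive and all admissible labels get the same weight: [q^-t1] divided by the two
    numbers of position sets. *)
Lemma uniform_insdel N t1 t2 : (t2 <= N)%N ->
  exists (Phi1 : op R q (N - t2) -> op R q (N - t2 + t1))
         (Phi2 : op R q N -> op R q (N - t2)) (c : C),
  [/\ ins_channel Phi1, del_channel Phi2, 0 < c &
      forall rho z z', Phi1 (Phi2 rho) z z' =
        c * \sum_(l : kraus_label q N t1 t2) \sum_x \sum_y
              kraus_op R d l z x * rho x y * conjc (kraus_op R d l z' y)].
Proof.
move=> t2N; pose n := (N - t2 + t1)%N.
pose s : t1.-tuple (qstate R q) := nseq_tuple t1 mixed_state.
have sE i : tnth s i = mixed_state by rewrite (tnth_nth mixed_state) /= nth_nseq ltn_ord.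
(* The inserted product state is fixed, so a one-point probability space suffices. *)
pose mu : probability unit R := \d_tt.
pose F (rho : op R q (N - t2)) z z' (w : unit) := \sum_(Q : {set 'I_n} | #|Q| == t1)
  (uniform_weight t1 Q)%:C%C * Ins Q s rho z z'.
pose Phi1 (rho : op R q (N - t2)) : op R q n := fun z z' => cint mu (F rho z z').
pose Phi2 (rho : op R q N) : op R q (N - t2) := fun x y =>
  \sum_(P : {set 'I_N} | #|P| == t2) (uniform_weight t2 P)%:C%C * Era (t := t2) P rho x y.
have w0 m t (P : {set 'I_m}) : 0 <= uniform_weight t P.
  by rewrite /uniform_weight; case: ifP; rewrite // invr_ge0 ler0n.
have wn m t (P : {set 'I_m}) : #|P| != t -> uniform_weight t P = 0.
  by rewrite /uniform_weight => /negbTE ->.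
pose c1 : C := (('C(n, t1))%:R^-1 : R)%:C%C; pose c2 : C := (('C(N, t2))%:R^-1 : R)%:C%C.
pose k := c1 * (q%:R^-1 : C) ^+ t1.
exists Phi1, Phi2, (k * c2); split.
- exists _, unit, mu, (fun=> s), (fun _ => @uniform_weight n t1).
  split; first by move=> w i; rewrite sE; apply: density_mixed_state.
  split; first by move=> w P; apply: w0.
  split; first by move=> w P; apply: wn.
  split; first by move=> w; apply: sum_uniform_weight; rewrite leq_addl.
  split; first by move=> i a b; split; apply: measurable_cst.
  by split=> // P; apply: measurable_cst.
- exists (@uniform_weight N t2); split; [exact: w0|exact: wn|exact: sum_uniform_weight|by []].
- have q0 : (0 < q)%N := leq_ltn_trans (leq0n _) (ltn_ord d).
  rewrite /k /c1 /c2 !mulr_gt0 ?exprn_gt0 ?invr_gt0 ?ltr0n //;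
  by rewrite -(rmorph0 (real_complex R)) ltcR invr_gt0 ltr0n bin_gt0 // leq_addl.
pose g (Q : {set 'I_n}) (b b' : seq 'I_q) : C := c1 * \prod_(i < t1) mixed_state (nth d b i) (nth d b' i).
have Phi1E rho z z' : Phi1 rho z z' = \sum_(Q : {set 'I_n} | #|Q| == t1)
    g Q (sel d (positions Q) (word z)) (sel d (positions Q) (word z')) *
    rho (toidx d (N - t2) (cut (positions Q) (word z)))
        (toidx d (N - t2) (cut (positions Q) (word z'))).
  rewrite /Phi1 [F rho z z'](_ : _ = fun=> F rho z z' tt); last by apply/funext; case.
  rewrite cint_cst; apply: eq_bigr => Q Qt.
  rewrite (InsE d) ?(eqP Qt) // mulrA /g /uniform_weight Qt; congr (_ * _ * _).
  by apply: eq_bigr => i _; rewrite sE.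
have Phi2E rho x y : Phi2 rho x y = \sum_(P : {set 'I_N} | #|P| == t2)
    c2 * Era (t := t2) P rho x y.
  by apply: eq_bigr => P Pt; rewrite /uniform_weight Pt.
move=> rho z z'; rewrite (insdel_kraus_form t2N Phi1E Phi2E) sum_pair mulr_sumr.
apply: eq_bigr => -[[[Q P] a] b] _.
have gE (b' : t1.-tuple 'I_q) : g Q b b' = k * (b == b')%:R.
  rewrite /g /k -mulrA; congr (_ * _).
  case: (eqVneq b b') => [<-|ne].
    rewrite mulr1 -[in RHS](card_ord t1) -prodr_const; apply: eq_bigr => i _.
    by rewrite /mixed_state eqxx mul1r.
  rewrite mulr0; apply/eqP; rewrite prodf_seq_eq0.
  apply: contraT => /hasPn H; case/eqP: ne; apply/eq_from_tnth => i.
  rewrite !(tnth_nth d); apply/eqP; apply: contraT => ni.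
  have := H i (mem_index_enum _).
  by rewrite /mixed_state (negbTE ni) mul0r eqxx.
rewrite (bigD1 b) //= gE eqxx mulr1 [X in _ + X]big1 ?addr0 // => b' ne.
by rewrite gE eq_sym (negbTE ne) mulr0 !mul0r.
Qed.

End UniformChannel.

Theorem theorem2p5 (R : realType) (q N t1 t2 s1 s2 : nat)
    (S : Defs.vec R q N -> Prop) :
  (1 < q)%N -> (0 < N)%N -> (t2 < N)%N -> (s2 < N)%N ->
  (t1 + t2 = s1 + s2)%N ->
  Defs.code_subspace S ->
  @Defs.insdel_code R q N t1 t2 S -> @Defs.insdel_code R q N s1 s2 S.
Proof.
move=> q1 _ t2N s2N ts Ssp code Phi1 Phi2 insPhi1 delPhi2.
have q0 : (0 < q)%N := ltnW q1; pose d : 'I_q := Ordinal q0.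
have [Psi1 [Psi2 [c [insPsi delPsi c0 PsiE]]]] := uniform_insdel R d t1 (ltnW t2N).
(* Every operator [kraus_op] occurs in this channel with the positive weight [c], so a single
   recovery controls all pairs of labels. *)
have [Rec [chRec recE]] := code Psi1 Psi2 insPsi delPsi.
have orth_t := recovery_orthogonality c0 Ssp chRec PsiE recE.
have orth_s := kraus_orthogonality t2N s2N ts orth_t.
have [tr1 [g Phi1E]] := ins_channel_coef d insPhi1.
have [p [_ _ _ Phi2E]] := delPhi2.
pose J : finType := ({set 'I_(N - s2 + s1)} * {set 'I_N} * s2.-tuple 'I_q *
                     s1.-tuple 'I_q * s1.-tuple 'I_q)%type.
apply: (@channel_recovery R q N _ J (kraus_label q N s1 s2) S (fun rho => Phi1 (Phi2 rho))
  (fun j => let: (Q, P, a, b, b') := j in g Q b b' * (p P)%:C%C)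
  (fun j => let: (Q, P, a, b, b') := j in (Q, P, a, b))
  (fun j => let: (Q, P, a, b, b') := j in (Q, P, a, b'))
  (@kraus_op R q d N s1 s2) q0 Ssp) => //.
- move=> rho z z'; rewrite (insdel_kraus_form (ltnW s2N) Phi1E Phi2E).
  by apply: eq_bigr => -[[[[Q P] a] b] b'] _.
- by move=> rho [_ trrho]; rewrite tr1 (mtrace_del_channel d rho delPhi2).
Qed.
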